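(* Let $\mu,\nu\in\mathbb{R}$ and let $f\in C_b^1([0,\infty))$ with $\lim_{x\to\infty}f(x)=0$. Then there exists a unique function $u$ satisfying $u\in C^\infty((0,\infty)\times[0,\infty))$, $u,u_x\in C_b([0,T]\times[0,\infty))$ for every $T>0$, $\lim_{x\to\infty}u(t,x)=0$ for every $t>0$, and solving the initial boundary value problem \[ u_t=\mu u_x+\tfrac12 u_{xx}\ \ (t>0,\ x\ge 0),\qquad u(0,x)=f(x)\ \ (x\ge 0),\qquad u_t(t,0)=\nu u_x(t,0)\ \ (t>0). \]
   Context: $C_b^1([0,\infty))$ denotes the set of $C^1$ functions $f$ on $[0,\infty)$ such that $f$ and $f'$ are bounded on $[0,\infty)$. $C_b(A)$ denotes bounded continuous functions on $A$. No sign restriction is imposed on $\nu$ (in particular $\nu<0$ is allowed). *)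

(* Defs.v *)
From Stdlib Require Import Reals.
Open Scope R_scope.

(* Derivative of g : R -> R at x relative to a set S (one-sided at boundary
   points of S, e.g. at 0 for S = [0,oo)). *)
Definition has_deriv_within (S : R -> Prop) (g : R -> R) (x l : R) : Prop :=
  forall eps, 0 < eps -> exists delta, 0 < delta /\
    forall h, h <> 0 -> Rabs h < delta -> S (x + h) ->
      Rabs ((g (x + h) - g x) / h - l) < eps.

Definition halfline (y : R) : Prop := 0 <= y.
Definition pos_halfline (y : R) : Prop := 0 < y.

Definition pd_t (u : R -> R -> R) (t x l : R) : Prop :=
  has_deriv_within pos_halfline (fun s => u s x) t l.
Definition pd_x (u : R -> R -> R) (t x l : R) : Prop :=
  has_deriv_within halfline (fun y => u t y) x l.

Definition cont2_on (S : R -> R -> Prop) (g : R -> R -> R) : Prop :=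
  forall t x, S t x -> forall eps, 0 < eps -> exists delta, 0 < delta /\
    forall t' x', S t' x' -> Rabs (t' - t) < delta -> Rabs (x' - x) < delta ->
      Rabs (g t' x' - g t x) < eps.
Definition bdd2_on (S : R -> R -> Prop) (g : R -> R -> R) : Prop :=
  exists M, forall t x, S t x -> Rabs (g t x) <= M.

Definition Dom (t x : R) : Prop := 0 < t /\ 0 <= x.
Definition strip (T t x : R) : Prop := 0 <= t <= T /\ 0 <= x.

Fixpoint Ck_Dom (k : nat) (u : R -> R -> R) : Prop :=
  cont2_on Dom u /\
  match k with
  | O => True
  | S k' => exists ut ux : R -> R -> R,
      (forall t x, Dom t x -> pd_t u t x (ut t x) /\ pd_x u t x (ux t x)) /\
      Ck_Dom k' ut /\ Ck_Dom k' ux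
  end.

Definition Cinf_Dom (u : R -> R -> R) : Prop := forall k, Ck_Dom k u.

Definition C1b_halfline (f : R -> R) : Prop :=
  exists f' : R -> R,
    (forall x, 0 <= x -> has_deriv_within halfline f x (f' x)) /\
    (forall x, 0 <= x -> forall eps, 0 < eps -> exists delta, 0 < delta /\
        forall y, 0 <= y -> Rabs (y - x) < delta -> Rabs (f' y - f' x) < eps) /\
    (exists M, forall x, 0 <= x -> Rabs (f x) <= M) /\
    (exists M, forall x, 0 <= x -> Rabs (f' x) <= M).

Definition tends_to_0_at_infty (g : R -> R) : Prop :=
  forall eps, 0 < eps -> exists A, forall x, A <= x -> Rabs (g x) < eps.

Definition is_solution (mu nu : R) (f : R -> R) (u : R -> R -> R) : Prop :=
  Cinf_Dom u /\
  (exists ux : R -> R -> R,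
     (forall t x, 0 <= t -> 0 <= x -> pd_x u t x (ux t x)) /\
     (forall T, 0 < T ->
        cont2_on (strip T) u /\ bdd2_on (strip T) u /\
        cont2_on (strip T) ux /\ bdd2_on (strip T) ux)) /\
  (forall t, 0 < t -> tends_to_0_at_infty (u t)) /\
  (exists ut ux uxx : R -> R -> R,
     (forall t x, Dom t x ->
        pd_t u t x (ut t x) /\ pd_x u t x (ux t x) /\ pd_x ux t x (uxx t x)) /\
     (forall t x, Dom t x -> ut t x = mu * ux t x + / 2 * uxx t x) /\
     (forall t, 0 < t -> ut t 0 = nu * ux t 0)) /\
  (forall x, 0 <= x -> u 0 x = f x).

(* Main.v *)
(* The slope [w = u_x] solves the same equation, and on solutions the boundary
   condition [u_t = nu u_x] becomes the Robin condition
   [w_x (t, 0) = 2 (nu - mu) w (t, 0)].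

   Existence. Gauging away the drift, [exp (mu x) (w_x / 2 + (mu - nu) w)] should
   vanish at [x = 0], so one extends [f'] to a function [W] on the real line for
   which this expression is odd at time [0]; the extension solves a first-order
   linear ODE, needs only continuity of [f'], and grows at most exponentially.
   With [F] the primitive of [W], [u] and [w] are the Gaussian averages of [F] and
   [W], and folding the integral at [x = 0] gives the Robin condition.

   Uniqueness. The difference of two slopes vanishes at time [0] and is bounded on
   strips, so it is zero by a weighted maximum principle; the difference of the
   solutions is then constant in [x] and tends to [0]. *)

From Stdlib Require Import Reals Lra Classical ClassicalEpsilon List.
From Coquelicot Require Import Coquelicot.
Require Import Defs.
Open Scope R_scope.
Set Bullet Behavior "Strict Subproofs".

(** * Integrals over the line *)

(** Inserting the equation into the boundary condition produces a condition on [u_xx], one order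
    more than a [C^1] datum can carry. For the slope it is of first order, and once integrated
    against a Gaussian, with the derivative moved onto the kernel, it involves only values of the
    extension [W], which is merely continuous.

    The same Gaussian average is used in two forms. In the standardised variable ([heat]) it makes
    sense at [t = 0] and is suited to bounds, to decay and to continuity up to the initial time.
    With the kernel expanded ([heat_moment]) the parameters sit in a smooth weight, so all
    derivatives fall on that weight and none on the data. Since the average runs over the whole
    line, [x = 0] is an interior point for it and smoothness up to the boundary is automatic.

    As [nu] has no sign, the Robin coefficient may have the unfavourable one. This shapes both
    halves: the extension can grow exponentially to the left, so every estimate carries an
    exponential weight, and the maximum principle must compare with a barrier steep enough at [0] to
    beat the coefficient. *)

Definition cont (g : R -> R) : Prop := forall y, continuous g y.

Lemma cont_const (c : R) : cont (fun _ => c).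
Proof. intros y; apply continuous_const. Qed.

Lemma cont_id : cont (fun y => y).
Proof. intros y; apply continuous_id. Qed.

Lemma cont_plus (f g : R -> R) : cont f -> cont g -> cont (fun y => f y + g y).
Proof. intros hf hg y; apply (continuous_plus f g); auto. Qed.

Lemma cont_opp (f : R -> R) : cont f -> cont (fun y => - f y).
Proof. intros hf y; apply (continuous_opp f); auto. Qed.

Lemma cont_minus (f g : R -> R) : cont f -> cont g -> cont (fun y => f y - g y).
Proof. intros hf hg; apply cont_plus; [exact hf | now apply cont_opp]. Qed.

Lemma cont_mult (f g : R -> R) : cont f -> cont g -> cont (fun y => f y * g y).
Proof. intros hf hg y; apply (continuous_mult f g); auto. Qed.

Lemma cont_comp (f g : R -> R) : cont f -> cont g -> cont (fun y => f (g y)).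
Proof. intros hf hg y; apply (continuous_comp g f); auto. Qed.

Lemma cont_exp (f : R -> R) : cont f -> cont (fun y => exp (f y)).
Proof.
  intros hf; apply (cont_comp exp f); [|exact hf].
  intros y; apply continuity_pt_filterlim, derivable_continuous_pt, derivable_pt_exp.
Qed.

Lemma cont_pow (f : R -> R) (n : nat) : cont f -> cont (fun y => f y ^ n).
Proof.
  intros hf; induction n as [|n IH]; simpl.
  - apply cont_const.
  - now apply cont_mult.
Qed.

Lemma cont_Rabs : cont Rabs.
Proof. intros y; apply continuous_Rabs. Qed.

Lemma cont_posneg : cont (fun y => Rmax 0 (- y)).
Proof.
  intros y.
  apply (continuous_ext (fun y => / 2 * (Rabs y - y))).
  - intros z; unfold Rabs, Rmax; destruct (Rcase_abs z), (Rle_dec 0 (- z)); lra.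
  - apply (cont_mult (fun _ => / 2)); [apply cont_const|].
    apply cont_minus; [apply cont_Rabs | apply cont_id].
Qed.

Lemma cont_ex_RInt (g : R -> R) (a b : R) : cont g -> ex_RInt g a b.
Proof. intros hg; apply (ex_RInt_continuous g); intros; apply hg. Qed.

Ltac cont_tac :=
  repeat first
    [ assumption | apply cont_const | apply cont_id | apply cont_Rabs
    | apply cont_posneg
    | apply cont_exp | apply cont_pow | apply cont_opp
    | apply cont_minus | apply cont_plus | apply cont_mult ].

Lemma exp_le_compat (x y : R) : x <= y -> exp x <= exp y.
Proof. intros [h|h]; [left; now apply exp_increasing | right; now f_equal]. Qed.

(** The constant is a parameter rather than existentially bound, so that bounds uniform in [t] and
    [x], and Taylor remainders with a small constant, can be expressed. *)
Definition rapid_by (C : R) (g : R -> R) : Prop :=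
  cont g /\ forall y, Rabs (g y) <= C * exp (- Rabs y).

(* Junk unless the symmetric limit exists, as it does under [rapid_by]. *)
Definition integral (g : R -> R) : R :=
  real (Lim_seq (fun n => RInt g (- INR n) (INR n))).

Lemma is_RInt_exp_neg (a b : R) : is_RInt (fun y => exp (- y)) a b (exp (- a) - exp (- b)).
Proof.
  replace (exp (- a) - exp (- b)) with (minus (- exp (- b)) (- exp (- a)))
    by (unfold minus, plus, opp; simpl; ring).
  apply (is_RInt_derive (fun y => - exp (- y)) (fun y => exp (- y))).
  - intros x _; auto_derive; [trivial | ring].
  - intros x _; revert x; apply cont_exp, cont_opp, cont_id.
Qed.

Lemma is_RInt_exp_pos (a b : R) : is_RInt exp a b (exp b - exp a).
Proof.
  apply (is_RInt_derive exp exp).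
  - intros x _; apply is_derive_exp.
  - intros x _; apply (cont_exp (fun y => y)), cont_id.
Qed.

Lemma rapid_by_nonneg (C : R) (g : R -> R) : rapid_by C g -> 0 <= C.
Proof.
  intros [_ h]; specialize (h 0); rewrite Rabs_R0, Ropp_0, exp_0 in h.
  pose proof (Rabs_pos (g 0)); lra.
Qed.

Lemma RInt_tail_pos (C : R) (g : R -> R) (a b : R) :
  rapid_by C g -> 0 <= a <= b -> Rabs (RInt g a b) <= C * exp (- a).
Proof.
  intros [hc hb] hab.
  pose proof (rapid_by_nonneg C g (conj hc hb)) as hC.
  apply Rle_trans with (C * (exp (- a) - exp (- b))).
  - apply (norm_RInt_le g (fun y => C * exp (- y)) a b); [lra| | |].
    + intros x hx; specialize (hb x); rewrite (Rabs_pos_eq x) in hb by lra; exact hb.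
    + apply (RInt_correct (V := R_CompleteNormedModule)), cont_ex_RInt, hc.
    + apply (is_RInt_scal (V := R_NormedModule) (fun y => exp (- y))), is_RInt_exp_neg.
  - apply Rmult_le_compat_l; [lra|]. pose proof (exp_pos (- b)); lra.
Qed.

Lemma RInt_tail_neg (C : R) (g : R -> R) (a b : R) :
  rapid_by C g -> a <= b <= 0 -> Rabs (RInt g a b) <= C * exp b.
Proof.
  intros [hc hb] hab.
  pose proof (rapid_by_nonneg C g (conj hc hb)) as hC.
  apply Rle_trans with (C * (exp b - exp a)).
  - apply (norm_RInt_le g (fun y => C * exp y) a b); [lra| | |].
    + intros x hx; specialize (hb x); rewrite (Rabs_left1 x), Ropp_involutive in hb by lra.
      exact hb.
    + apply (RInt_correct (V := R_CompleteNormedModule)), cont_ex_RInt, hc.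
    + apply (is_RInt_scal (V := R_NormedModule) exp), is_RInt_exp_pos.
  - apply Rmult_le_compat_l; [lra|]. pose proof (exp_pos a); lra.
Qed.

Lemma RInt_nested_diff (C : R) (g : R -> R) (m a b a' b' : R) :
  rapid_by C g -> 0 <= m -> m <= b <= b' -> a' <= a <= - m ->
  Rabs (RInt g a' b' - RInt g a b) <= 2 * C * exp (- m).
Proof.
  intros hg hm hb ha.
  pose proof (rapid_by_nonneg C g hg) as hC.
  assert (hx : forall p q, ex_RInt g p q) by (intros; apply cont_ex_RInt, hg).
  rewrite <- (RInt_Chasles g a' a b') by apply hx.
  rewrite <- (RInt_Chasles g a b b') by apply hx.
  unfold plus; simpl.
  replace (RInt g a' a + (RInt g a b + RInt g b b') - RInt g a b)
    with (RInt g a' a + RInt g b b') by ring.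
  eapply Rle_trans; [apply Rabs_triang|].
  assert (h1 := RInt_tail_neg C g a' a hg ltac:(lra)).
  assert (h2 := RInt_tail_pos C g b b' hg ltac:(lra)).
  assert (exp a <= exp (- m)) by (apply exp_le_compat; lra).
  assert (exp (- b) <= exp (- m)) by (apply exp_le_compat; lra).
  nra.
Qed.

Lemma exp_neg_INR_small (C eps : R) : 0 < eps ->
  exists N : nat, forall n, (N <= n)%nat -> C * exp (- INR n) < eps.
Proof.
  intros he.
  destruct (INR_unbounded (Rabs C / eps)) as [N hN].
  exists N; intros n hn; apply le_INR in hn.
  assert (h1 : 1 + INR n <= exp (INR n)) by apply exp_ineq1_le.
  pose proof (exp_pos (INR n)); pose proof (pos_INR n).
  rewrite exp_Ropp.
  apply Rmult_lt_reg_r with (exp (INR n)); [lra|].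
  rewrite Rmult_assoc, Rinv_l, Rmult_1_r by lra.
  assert (Rabs C < INR N * eps).
  { apply Rmult_lt_reg_r with (/ eps); [now apply Rinv_0_lt_compat|].
    rewrite Rmult_assoc, Rinv_r, Rmult_1_r by lra. exact hN. }
  pose proof (Rle_abs C). nra.
Qed.

Lemma integral_lim (C : R) (g : R -> R) : rapid_by C g ->
  is_lim_seq (fun n => RInt g (- INR n) (INR n)) (integral g).
Proof.
  intros hg; apply Lim_seq_correct', ex_lim_seq_cauchy_corr.
  intros eps.
  destruct (exp_neg_INR_small (2 * C) eps (cond_pos eps)) as [N hN].
  assert (key : forall n m, (N <= n)%nat -> (n <= m)%nat ->
    Rabs (RInt g (- INR m) (INR m) - RInt g (- INR n) (INR n)) < eps).
  { intros n m hn hm; apply le_INR in hm.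
    eapply Rle_lt_trans; [|apply (hN n hn)].
    apply RInt_nested_diff; auto; try lra. apply pos_INR. }
  exists N; intros n m hn hm.
  destruct (Nat.le_ge_cases n m); [rewrite Rabs_minus_sym|]; apply key; auto.
Qed.

Lemma integral_unique (g : R -> R) (l : R) :
  is_lim_seq (fun n => RInt g (- INR n) (INR n)) l -> integral g = l.
Proof. intros h; unfold integral; now rewrite (is_lim_seq_unique _ _ h). Qed.

Lemma integral_ext (g h : R -> R) : (forall y, g y = h y) -> integral g = integral h.
Proof.
  intros e; unfold integral; f_equal; apply Lim_seq_ext; intros n.
  apply RInt_ext; intros; apply e.
Qed.

Lemma rapid_by_lin (C D a b : R) (g h : R -> R) :
  rapid_by C g -> rapid_by D h ->
  rapid_by (Rabs a * C + Rabs b * D) (fun y => a * g y + b * h y).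
Proof.
  intros [hc hg] [hd hh]; split.
  - cont_tac.
  - intros y; eapply Rle_trans; [apply Rabs_triang|]; rewrite !Rabs_mult.
    specialize (hg y); specialize (hh y).
    pose proof (Rabs_pos a); pose proof (Rabs_pos b). nra.
Qed.

Lemma integral_lin (C D a b : R) (g h : R -> R) :
  rapid_by C g -> rapid_by D h ->
  integral (fun y => a * g y + b * h y) = a * integral g + b * integral h.
Proof.
  intros hg hh; apply integral_unique.
  apply (is_lim_seq_ext (fun n => a * RInt g (- INR n) (INR n) + b * RInt h (- INR n) (INR n))).
  - intros n; symmetry; apply is_RInt_unique.
    apply (is_RInt_plus (V := R_NormedModule));
      apply (is_RInt_scal (V := R_NormedModule)); apply (RInt_correct (V := R_CompleteNormedModule)); apply cont_ex_RInt;
      [apply hg | apply hh].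
  - apply (is_lim_seq_plus' (fun n => a * _) (fun n => b * _));
      [apply (is_lim_seq_scal_l _ a (integral g)) | apply (is_lim_seq_scal_l _ b (integral h))];
      eapply integral_lim; eassumption.
Qed.

Lemma integral_scal (C a : R) (g : R -> R) : rapid_by C g ->
  integral (fun y => a * g y) = a * integral g.
Proof.
  intros hg; rewrite <- (Rplus_0_r (a * integral g)), <- (Rmult_0_l (integral g)).
  rewrite <- (integral_lin C C a 0 g g hg hg).
  apply integral_ext; intros; ring.
Qed.

(** The truncation interval need not be symmetric, which is what an affine change of variables
    requires; [m = 0] gives the bound of the whole integral. *)
Lemma integral_near (C : R) (g : R -> R) (m a b : R) :
  rapid_by C g -> 0 <= m -> m <= b -> a <= - m ->
  Rabs (integral g - RInt g a b) <= 2 * C * exp (- m).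
Proof.
  intros hg hm hb ha.
  apply (is_lim_seq_le_loc
    (fun n => Rabs (RInt g (- INR n) (INR n) - RInt g a b)) (fun _ => 2 * C * exp (- m))
    (Rabs (integral g - RInt g a b)) (2 * C * exp (- m))).
  - destruct (INR_unbounded (Rmax b (- a))) as [N hN].
    exists N; intros n hn; apply le_INR in hn.
    pose proof (Rmax_l b (- a)); pose proof (Rmax_r b (- a)).
    apply RInt_nested_diff; auto; lra.
  - apply (is_lim_seq_abs _ (integral g - RInt g a b)).
    apply (is_lim_seq_minus' _ (fun _ => RInt g a b)).
    + eapply integral_lim; eassumption.
    + apply is_lim_seq_const.
  - apply is_lim_seq_const.
Qed.

Lemma integral_bound (C : R) (g : R -> R) : rapid_by C g -> Rabs (integral g) <= 2 * C.
Proof.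
  intros hg.
  pose proof (integral_near C g 0 0 0 hg ltac:(lra) ltac:(lra) ltac:(lra)) as h.
  rewrite RInt_point, Ropp_0, exp_0 in h. unfold zero in h; simpl in h.
  rewrite Rminus_0_r in h; lra.
Qed.

(** The substitution turns the symmetric intervals that define [integral] into off-centre ones;
    these still exhaust the line, with an error controlled by [integral_near]. *)
Lemma integral_affine (C C' p b : R) (g : R -> R) : 0 < b ->
  rapid_by C g -> rapid_by C' (fun z => b * g (b * z + p)) ->
  integral (fun z => b * g (b * z + p)) = integral g.
Proof.
  intros hb hg hg'; apply integral_unique.
  apply (is_lim_seq_ext (fun n => RInt g (b * - INR n + p) (b * INR n + p))).
  { intros n; symmetry; apply (RInt_comp_lin g b p).
    apply cont_ex_RInt, hg. }
  apply is_lim_seq_spec; intros eps.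
  destruct (exp_neg_INR_small (2 * C) eps (cond_pos eps)) as [N hN].
  (* For [n >= M] both endpoints [p - b * n] and [p + b * n] lie at distance at least [N] from the
     origin. *)
  destruct (INR_unbounded ((INR N + Rabs p) / b)) as [M hM].
  exists M; intros n hn; apply le_INR in hn.
  assert (INR N + Rabs p < b * INR n).
  { apply Rmult_lt_reg_r with (/ b); [now apply Rinv_0_lt_compat|].
    replace (b * INR n * / b) with (INR n) by (field; lra).
    unfold Rdiv in hM; lra. }
  rewrite Rabs_minus_sym.
  eapply Rle_lt_trans; [|apply (hN N (le_n _))].
  pose proof (Rle_abs p); pose proof (Rle_abs (- p)) as hp; rewrite Rabs_Ropp in hp.
  apply integral_near; auto; [apply pos_INR| |]; lra.
Qed.

Lemma exp_neg_INR_lim (C : R) : is_lim_seq (fun n => C * exp (- INR n)) 0.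
Proof.
  apply is_lim_seq_spec; intros eps.
  destruct (exp_neg_INR_small (Rabs C) eps (cond_pos eps)) as [N hN].
  exists N; intros n hn; rewrite Rminus_0_r, Rabs_mult, (Rabs_pos_eq (exp _)).
  - now apply hN.
  - apply Rlt_le, exp_pos.
Qed.

Lemma integral_derivative (C : R) (g dg : R -> R) :
  (forall y, is_derive g y (dg y)) -> cont dg -> rapid_by C g ->
  integral dg = 0.
Proof.
  intros hd hc hg; apply integral_unique.
  apply (is_lim_seq_ext (fun n => g (INR n) - g (- INR n))).
  { intros n; symmetry; apply is_RInt_unique.
    apply (is_RInt_derive g dg); intros; [apply hd | apply hc]. }
  apply is_lim_seq_abs_0.
  apply (is_lim_seq_le_le (fun _ => 0) _ (fun n => 2 * C * exp (- INR n))).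
  - intros n; split; [apply Rabs_pos|].
    eapply Rle_trans; [apply Rabs_triang|]; rewrite Rabs_Ropp.
    pose proof (proj2 hg (INR n)) as h1; pose proof (proj2 hg (- INR n)) as h2.
    rewrite Rabs_Ropp in h2; rewrite (Rabs_pos_eq (INR n)) in h1, h2 by apply pos_INR.
    lra.
  - apply is_lim_seq_const.
  - apply exp_neg_INR_lim.
Qed.

Lemma integral_pos (C : R) (g : R -> R) :
  rapid_by C g -> (forall y, 0 < g y) -> 0 < integral g.
Proof.
  intros hg hp.
  assert (hx : forall a b, ex_RInt g a b) by (intros; apply cont_ex_RInt, hg).
  assert (h1 : 0 < RInt g (-1) 1).
  { apply RInt_gt_0; [lra | intros; apply hp | intros; apply hg]. }
  apply Rlt_le_trans with (1 := h1).
  apply (is_lim_seq_le_loc (fun _ => RInt g (-1) 1) (fun n => RInt g (- INR n) (INR n))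
    (RInt g (-1) 1) (integral g)).
  - exists 1%nat; intros n hn; apply le_INR in hn; simpl in hn.
    rewrite <- (RInt_Chasles g (- INR n) (-1) (INR n)), <- (RInt_Chasles g (-1) 1 (INR n))
      by apply hx.
    assert (0 <= RInt g (- INR n) (-1))
      by (apply RInt_ge_0; [lra | apply hx | intros; apply Rlt_le, hp]).
    assert (0 <= RInt g 1 (INR n))
      by (apply RInt_ge_0; [lra | apply hx | intros; apply Rlt_le, hp]).
    unfold plus; simpl; lra.
  - apply is_lim_seq_const.
  - eapply integral_lim; eassumption.
Qed.

(** * Moments against Gaussian exponentials *)

(* Only the growth at -oo matters: the data are bounded on the half-line, and
   their extension to the negative axis grows at most exponentially. *)
Definition growth_by (A K : R) (F : R -> R) : Prop :=
  cont F /\ 0 <= K /\ forall y, Rabs (F y) <= A * exp (K * Rmax 0 (- y)).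

Lemma growth_by_nonneg (A K : R) (F : R -> R) : growth_by A K F -> 0 <= A.
Proof.
  intros (_ & _ & h); specialize (h 0).
  rewrite Ropp_0, Rmax_left, Rmult_0_r, exp_0 in h by lra.
  pose proof (Rabs_pos (F 0)); lra.
Qed.

Lemma growth_by_abs (A K : R) (F : R -> R) (y : R) :
  growth_by A K F -> Rabs (F y) <= A * exp (K * Rabs y).
Proof.
  intros hF; pose proof (growth_by_nonneg A K F hF) as hA.
  destruct hF as (_ & hK & h).
  eapply Rle_trans; [apply h|].
  apply Rmult_le_compat_l; [exact hA|]; apply exp_le_compat, Rmult_le_compat_l; [exact hK|].
  apply Rmax_lub; [apply Rabs_pos|]. rewrite <- Rabs_Ropp; apply Rle_abs.
Qed.

Lemma pow_le_exp (n : nat) (x : R) : 0 <= x -> x ^ n <= exp (INR n * x).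
Proof.
  intros hx; induction n as [|n IH].
  - simpl; rewrite Rmult_0_l, exp_0; lra.
  - rewrite S_INR, Rmult_plus_distr_r, Rmult_1_l, exp_plus; simpl.
    pose proof (exp_ineq1_le x).
    rewrite (Rmult_comm _ (exp x)).
    apply Rmult_le_compat; [lra | now apply pow_le | lra | exact IH].
Qed.

(** The power costs [exp (n * x)] and the required decay costs [exp x], with [x = Rabs y];
    completing the square then bounds [q * x - s * x ^ 2] by [q ^ 2 / (4 * s)]. *)
Lemma gauss_bound (n : nat) (K s : R) : 0 < s ->
  exists C, 0 <= C /\
    forall y, Rabs y ^ n * exp (K * Rabs y - s * y ^ 2) <= C * exp (- Rabs y).
Proof.
  intros hs; set (q := INR n + K + 1).
  exists (exp (q ^ 2 / (4 * s))); split; [apply Rlt_le, exp_pos|].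
  intros y; pose proof (Rabs_pos y) as hy.
  eapply Rle_trans.
  { apply Rmult_le_compat_r; [apply Rlt_le, exp_pos | apply (pow_le_exp n _ hy)]. }
  rewrite <- !exp_plus; apply exp_le_compat.
  rewrite <- (pow2_abs y); set (x := Rabs y) in *.
  assert (0 <= s * (x - q / (2 * s)) ^ 2) by (apply Rmult_le_pos; [lra | apply pow2_ge_0]).
  replace (s * (x - q / (2 * s)) ^ 2) with (s * x ^ 2 - q * x + q ^ 2 / (4 * s)) in H
    by (field; lra).
  unfold q in *; lra.
Qed.

(** Differentiating in [r] multiplies by [y] and in [s] by [- y ^ 2], so parameter derivatives only
    shift [n]. The values of interest are [s = / (2 * t)] and [r = (x + mu * t) / t]. *)
Definition moment_density (n : nat) (s r : R) (F : R -> R) (y : R) : R :=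
  y ^ n * exp (r * y - s * y ^ 2) * F y.

Definition moment (n : nat) (F : R -> R) (s r : R) : R :=
  integral (moment_density n s r F).

Lemma moment_density_rapid (A K : R) (F : R -> R) (n : nat) (s r : R) :
  growth_by A K F -> 0 < s -> exists C, rapid_by C (moment_density n s r F).
Proof.
  intros hF hs.
  destruct (gauss_bound n (Rabs r + K) s hs) as [C [hC h]].
  pose proof (growth_by_nonneg A K F hF) as hA.
  exists (A * C); split.
  - destruct hF; unfold moment_density; cont_tac.
  - intros y; unfold moment_density; rewrite !Rabs_mult, <- RPow_abs.
    rewrite (Rabs_pos_eq (exp _)) by apply Rlt_le, exp_pos.
    pose proof (growth_by_abs A K F y hF) as hy.
    specialize (h y).
    assert (he : exp (r * y - s * y ^ 2) * exp (K * Rabs y)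
      <= exp ((Rabs r + K) * Rabs y - s * y ^ 2)).
    { rewrite <- exp_plus; apply exp_le_compat.
      pose proof (Rle_abs (r * y)) as h0; rewrite Rabs_mult in h0; lra. }
    apply Rle_trans with (Rabs y ^ n * exp (r * y - s * y ^ 2) * (A * exp (K * Rabs y))).
    { apply Rmult_le_compat_l; [|exact hy].
      apply Rmult_le_pos; [apply pow_le, Rabs_pos | apply Rlt_le, exp_pos]. }
    replace (Rabs y ^ n * exp (r * y - s * y ^ 2) * (A * exp (K * Rabs y)))
      with (A * (Rabs y ^ n * (exp (r * y - s * y ^ 2) * exp (K * Rabs y)))) by ring.
    rewrite Rmult_assoc; apply Rmult_le_compat_l; [exact hA|].
    eapply Rle_trans; [|exact h].
    apply Rmult_le_compat_l; [apply pow_le, Rabs_pos | exact he].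
Qed.

(** The inequality [1 + x <= exp x] at [d] and at [- d] gives
    [0 <= exp d - 1 - d <= d * (exp d - 1)], and the same two facts bound the last factor for either
    sign of [d]. *)
Lemma exp_taylor1 (d : R) : Rabs (exp d - 1 - d) <= d ^ 2 * (1 + exp d).
Proof.
  pose proof (exp_ineq1_le d) as h1.
  pose proof (exp_ineq1_le (- d)) as h2.
  pose proof (exp_pos d) as h3.
  assert (h4 : exp d * exp (- d) = 1) by (rewrite <- exp_plus, Rplus_opp_r; apply exp_0).
  assert (h5 : exp d * (1 - d) <= 1) by nra.
  rewrite Rabs_pos_eq by lra.
  destruct (Rle_dec 0 d); nra.
Qed.

Lemma exp_taylor1_gen (a b : R) :
  Rabs (exp a - exp b - (a - b) * exp b) <= (a - b) ^ 2 * (exp a + exp b).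
Proof.
  pose proof (exp_taylor1 (a - b)) as h; pose proof (exp_pos b) as hb.
  replace (exp a) with (exp b * exp (a - b)) by (rewrite <- exp_plus; f_equal; ring).
  replace (exp b * exp (a - b) - exp b - (a - b) * exp b)
    with (exp b * (exp (a - b) - 1 - (a - b))) by ring.
  rewrite Rabs_mult, Rabs_pos_eq by lra.
  apply Rle_trans with (exp b * ((a - b) ^ 2 * (1 + exp (a - b)))); [|apply Req_le; ring].
  apply Rmult_le_compat_l; lra.
Qed.

(** This takes the place of a theorem on differentiation under the integral: the remainder is
    quadratic in the increments with a majorant in [y] independent of them. Keeping
    [Rabs k <= s / 2] leaves half of the Gaussian weight to absorb polynomial and exponential
    factors. *)
Lemma moment_density_taylor (A K : R) (F : R -> R) (n : nat) (s r : R) :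
  growth_by A K F -> 0 < s ->
  exists C, 0 <= C /\ forall k h y, Rabs k <= s / 2 -> Rabs h <= 1 ->
    Rabs (moment_density n (s + k) (r + h) F y - moment_density n s r F y
          - h * moment_density (n + 1) s r F y + k * moment_density (n + 2) s r F y)
    <= (h ^ 2 + k ^ 2) * C * exp (- Rabs y).
Proof.
  intros hF hs.
  pose proof (growth_by_nonneg A K F hF) as hA.
  set (Q := Rabs r + 1 + K).
  destruct (gauss_bound (n + 2) Q (s / 2) ltac:(lra)) as [C1 [hC1 h1]].
  destruct (gauss_bound (n + 4) Q (s / 2) ltac:(lra)) as [C2 [hC2 h2]].
  exists (4 * A * (C1 + C2)); split; [nra|].
  intros k h y hk hh; unfold moment_density.
  set (a := (r + h) * y - (s + k) * y ^ 2); set (b := r * y - s * y ^ 2).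
  replace (y ^ n * exp a * F y - y ^ n * exp b * F y
      - h * (y ^ (n + 1) * exp b * F y) + k * (y ^ (n + 2) * exp b * F y))
    with (y ^ n * (exp a - exp b - (a - b) * exp b) * F y)
    by (rewrite !pow_add; unfold a, b; ring).
  rewrite !Rabs_mult, <- RPow_abs.
  set (x := Rabs y) in *.
  assert (hx : 0 <= x) by apply Rabs_pos.
  assert (hr : r * y <= Rabs r * x) by (unfold x; rewrite <- Rabs_mult; apply Rle_abs).
  assert (hhy : h * y <= x).
  { eapply Rle_trans; [apply Rle_abs|]; rewrite Rabs_mult; fold x; nra. }
  assert (hky : - (k * y ^ 2) <= s / 2 * y ^ 2).
  { pose proof (Rle_abs (- k)) as hk'; rewrite Rabs_Ropp in hk'.
    pose proof (pow2_ge_0 y); nra. }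
  (* A common majorant of the weights at the base point and at the shifted one. *)
  set (e := exp ((Rabs r + 1) * x - s / 2 * y ^ 2)).
  assert (ha : exp a <= e) by (apply exp_le_compat; unfold a; lra).
  assert (hb : exp b <= e).
  { apply exp_le_compat; unfold b; pose proof (pow2_ge_0 y); nra. }
  assert (he : 0 < e) by apply exp_pos.
  assert (hd : (a - b) ^ 2 <= 2 * (h ^ 2 + k ^ 2) * (x ^ 2 + x ^ 4)).
  { replace (x ^ 4) with ((x ^ 2) ^ 2) by ring; unfold x; rewrite pow2_abs.
    replace (a - b) with (h * y - k * y ^ 2) by (unfold a, b; ring).
    pose proof (pow2_ge_0 (h * y + k * y ^ 2)).
    pose proof (pow2_ge_0 (h * y ^ 2)). pose proof (pow2_ge_0 (k * y)). nra. }
  assert (hT : Rabs (exp a - exp b - (a - b) * exp b)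
      <= 4 * (h ^ 2 + k ^ 2) * (x ^ 2 + x ^ 4) * e).
  { eapply Rle_trans; [apply exp_taylor1_gen|].
    apply Rle_trans with (2 * (h ^ 2 + k ^ 2) * (x ^ 2 + x ^ 4) * (2 * e)); [|lra].
    apply Rmult_le_compat; [apply pow2_ge_0 | | exact hd | lra].
    pose proof (exp_pos a); pose proof (exp_pos b); lra. }
  pose proof (growth_by_abs A K F y hF) as hFy; fold x in hFy.
  specialize (h1 y); specialize (h2 y); fold x in h1, h2.
  assert (hn : 0 <= x ^ n) by now apply pow_le.
  eapply Rle_trans.
  { apply Rmult_le_compat; [|apply Rabs_pos| |exact hFy].
    - apply Rmult_le_pos; [exact hn | apply Rabs_pos].
    - apply Rmult_le_compat_l; [exact hn | exact hT]. }
  assert (eq : e * exp (K * x) = exp (Q * x - s / 2 * y ^ 2)).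
  { unfold e; rewrite <- exp_plus; f_equal; unfold Q; ring. }
  rewrite <- eq in h1, h2.
  replace (x ^ n * (4 * (h ^ 2 + k ^ 2) * (x ^ 2 + x ^ 4) * e) * (A * exp (K * x)))
    with (4 * A * (h ^ 2 + k ^ 2) * (x ^ (n + 2) * (e * exp (K * x)) + x ^ (n + 4) * (e * exp (K * x))))
    by (rewrite !pow_add; ring).
  replace ((h ^ 2 + k ^ 2) * (4 * A * (C1 + C2)) * exp (- x))
    with (4 * A * (h ^ 2 + k ^ 2) * (C1 * exp (- x) + C2 * exp (- x))) by ring.
  apply Rmult_le_compat_l; [|lra].
  pose proof (pow2_ge_0 h); pose proof (pow2_ge_0 k); nra.
Qed.

(** Joint differentiability is needed because varying [t] moves [s] and [r] simultaneously. *)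
Lemma moment_differentiable (A K : R) (F : R -> R) (n : nat) (s r : R) :
  growth_by A K F -> 0 < s ->
  differentiable_pt_lim (moment n F) s r (- moment (n + 2) F s r) (moment (n + 1) F s r).
Proof.
  intros hF hs eps.
  destruct (moment_density_taylor A K F n s r hF hs) as [C [hC hT]].
  (* The first two bounds make the Taylor estimate applicable. The third turns the integrated
     remainder, at most [4 * C * m ^ 2] for increments of size [m], into at most [eps * m]. *)
  set (d := Rmin (Rmin 1 (s / 2)) (eps / (4 * C + 1))).
  assert (hd1 : d <= 1) by (unfold d; eapply Rle_trans; [apply Rmin_l|apply Rmin_l]).
  assert (hd2 : d <= s / 2) by (unfold d; eapply Rle_trans; [apply Rmin_l|apply Rmin_r]).
  assert (hd3 : d <= eps / (4 * C + 1)) by apply Rmin_r.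
  assert (hd : 0 < d).
  { pose proof (cond_pos eps).
    repeat apply Rmin_glb_lt; try lra. apply Rdiv_lt_0_compat; lra. }
  exists (mkposreal d hd); intros s' r' hs' hr'; simpl in hs', hr'.
  set (k := s' - s) in *; set (h := r' - r) in *.
  replace s' with (s + k) by (unfold k; ring); replace r' with (r + h) by (unfold h; ring).
  assert (hsk : 0 < s + k) by (pose proof (Rabs_def2 k d hs'); lra).
  destruct (moment_density_rapid A K F n (s + k) (r + h) hF hsk) as [B0 r0].
  destruct (moment_density_rapid A K F n s r hF hs) as [B1 r1].
  destruct (moment_density_rapid A K F (n + 1) s r hF hs) as [B2 r2].
  destruct (moment_density_rapid A K F (n + 2) s r hF hs) as [B3 r3].
  pose proof (rapid_by_lin _ _ 1 (-1) _ _ r0 r1) as r01.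
  pose proof (rapid_by_lin _ _ (- h) k _ _ r2 r3) as r23.
  pose proof (rapid_by_lin _ _ 1 1 _ _ r01 r23) as rr.
  pose proof (integral_lin _ _ 1 1 _ _ r01 r23) as eq.
  rewrite (integral_lin _ _ 1 (-1) _ _ r0 r1), (integral_lin _ _ (- h) k _ _ r2 r3) in eq.
  replace (moment n F (s + k) (r + h) - moment n F s r
      - (- moment (n + 2) F s r * k + moment (n + 1) F s r * h))
    with (1 * (1 * moment n F (s + k) (r + h) + -1 * moment n F s r)
      + 1 * (- h * moment (n + 1) F s r + k * moment (n + 2) F s r)) by ring.
  unfold moment; rewrite <- eq.
  set (m := Rmax (Rabs k) (Rabs h)).
  assert (hkm : Rabs k <= m) by apply Rmax_l.
  assert (hhm : Rabs h <= m) by apply Rmax_r.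
  assert (hmd : m <= d) by (apply Rmax_lub; lra).
  assert (hm0 : 0 <= m) by (pose proof (Rabs_pos k); lra).
  assert (hq : h ^ 2 + k ^ 2 <= 2 * m ^ 2).
  { rewrite <- (pow2_abs h), <- (pow2_abs k).
    pose proof (Rabs_pos k); pose proof (Rabs_pos h).
    assert (Rabs h ^ 2 <= m ^ 2) by (apply pow_incr; lra).
    assert (Rabs k ^ 2 <= m ^ 2) by (apply pow_incr; lra). lra. }
  eapply Rle_trans.
  { apply (integral_bound ((h ^ 2 + k ^ 2) * C)); split; [apply rr|].
    intros y; eapply Rle_trans; [|apply (hT k h y); lra].
    apply Req_le; f_equal; ring. }
  assert (m * (4 * C + 1) <= eps).
  { apply Rle_trans with (eps / (4 * C + 1) * (4 * C + 1)).
    - apply Rmult_le_compat_r; lra.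
    - apply Req_le; field; lra. }
  nra.
Qed.

(** * Smoothness of heat moments *)

Lemma is_derive_within (S : R -> Prop) (g : R -> R) (x l : R) :
  is_derive g x l -> has_deriv_within S g x l.
Proof.
  intros hd eps he; apply is_derive_Reals in hd.
  destruct (hd eps he) as [d h].
  exists d; split; [apply cond_pos | intros; now apply h].
Qed.

Lemma is_derive_mult_eq (f g : R -> R) (x a b c : R) :
  is_derive f x a -> is_derive g x b -> c = a * g x + f x * b ->
  is_derive (fun y => f y * g y) x c.
Proof. intros hf hg ->; apply (is_derive_mult _ _ x _ _ hf hg Rmult_comm). Qed.

Lemma continuity_2d_pt_comp2 (f g h : R -> R -> R) (x y : R) :
  continuity_2d_pt f (g x y) (h x y) -> continuity_2d_pt g x y -> continuity_2d_pt h x y ->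
  continuity_2d_pt (fun u v => f (g u v) (h u v)) x y.
Proof.
  intros hf hg hh eps; destruct (hf eps) as [d hd].
  destruct (hg d) as [d1 h1]; destruct (hh d) as [d2 h2].
  assert (hm : 0 < Rmin d1 d2) by (apply Rmin_glb_lt; apply cond_pos).
  exists (mkposreal _ hm); simpl; intros u v hu hv.
  pose proof (Rmin_l d1 d2); pose proof (Rmin_r d1 d2).
  apply hd; [apply h1 | apply h2]; lra.
Qed.

(* Up to normalisation, the integral of [y ^ n * F y] against the heat kernel
   centred at [x + mu * t]; the square in the exponent has been expanded. *)
Definition heat_moment (mu : R) (F : R -> R) (n : nat) (t x : R) : R :=
  / sqrt t * exp (- (x + mu * t) ^ 2 / (2 * t))
  * moment n F (/ (2 * t)) ((x + mu * t) / t).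

(* The algebra generated by the heat moments, [x] and [/ t] is closed under both
   partial derivatives, which gives smoothness of all orders at once. *)
Inductive hexpr : Type :=
  | Const (c : R)
  | SpaceVar
  | InvTime
  | Moment (n : nat)
  | Add (e1 e2 : hexpr)
  | Mul (e1 e2 : hexpr).

Fixpoint eval (mu : R) (F : R -> R) (e : hexpr) (t x : R) : R :=
  match e with
  | Const c => c
  | SpaceVar => x
  | InvTime => / t
  | Moment n => heat_moment mu F n t x
  | Add e1 e2 => eval mu F e1 t x + eval mu F e2 t x
  | Mul e1 e2 => eval mu F e1 t x * eval mu F e2 t x
  end.

(** This is [(x + mu * t) / t], expanded so that only the generators [x] and [/ t] occur. *)
Definition Drift (mu : R) : hexpr := Add (Mul SpaceVar InvTime) (Const mu).

Fixpoint dx (mu : R) (e : hexpr) : hexpr :=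
  match e with
  | Const _ => Const 0
  | SpaceVar => Const 1
  | InvTime => Const 0
  | Moment n =>
      Add (Mul (Mul (Const (-1)) (Drift mu)) (Moment n)) (Mul InvTime (Moment (n + 1)))
  | Add e1 e2 => Add (dx mu e1) (dx mu e2)
  | Mul e1 e2 => Add (Mul (dx mu e1) e2) (Mul e1 (dx mu e2))
  end.

(** On a moment, with [D] the drift: [/ sqrt t] contributes [- / (2 * t)], the exponential prefactor
    [D ^ 2 / 2 - mu * D], and the parameters move at the rates [- x / t ^ 2] for [r] and
    [- / (2 * t ^ 2)] for [s]. *)
Fixpoint dt (mu : R) (e : hexpr) : hexpr :=
  match e with
  | Const _ => Const 0
  | SpaceVar => Const 0
  | InvTime => Mul (Const (-1)) (Mul InvTime InvTime)
  | Moment n =>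
      Add
        (Mul (Add (Mul (Const (- / 2)) InvTime)
               (Add (Mul (Const (/ 2)) (Mul (Drift mu) (Drift mu)))
                    (Mul (Const (- mu)) (Drift mu))))
             (Moment n))
        (Add (Mul (Mul (Const (-1)) (Mul SpaceVar (Mul InvTime InvTime))) (Moment (n + 1)))
             (Mul (Mul (Const (/ 2)) (Mul InvTime InvTime)) (Moment (n + 2))))
  | Add e1 e2 => Add (dt mu e1) (dt mu e2)
  | Mul e1 e2 => Add (Mul (dt mu e1) e2) (Mul e1 (dt mu e2))
  end.

Lemma inv_2t_pos (t : R) : 0 < t -> 0 < / (2 * t).
Proof. intros; apply Rinv_0_lt_compat; lra. Qed.

Lemma is_derive_eval_x (A K mu : R) (F : R -> R) (e : hexpr) (t x : R) :
  growth_by A K F -> 0 < t ->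
  is_derive (fun y => eval mu F e t y) x (eval mu F (dx mu e) t x).
Proof.
  intros hF ht; induction e as [c| | |n|e1 IH1 e2 IH2|e1 IH1 e2 IH2]; simpl.
  - apply (is_derive_const c).
  - apply (is_derive_id x).
  - apply (is_derive_const (/ t)).
  - unfold heat_moment.
    pose proof (moment_differentiable A K F n _ ((x + mu * t) / t) hF (inv_2t_pos t ht)) as hm.
    assert (h1 : is_derive (fun y => moment n F (/ (2 * t)) ((y + mu * t) / t)) x
      (/ t * moment (n + 1) F (/ (2 * t)) ((x + mu * t) / t))).
    { replace (/ t * moment (n + 1) F (/ (2 * t)) ((x + mu * t) / t))
        with (- moment (n + 2) F (/ (2 * t)) ((x + mu * t) / t) * 0
              + moment (n + 1) F (/ (2 * t)) ((x + mu * t) / t) * / t) by ring.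
      apply is_derive_Reals.
      apply (derivable_pt_lim_comp_2d (moment n F) (fun _ => / (2 * t)) (fun y => (y + mu * t) / t)).
      - exact hm.
      - apply derivable_pt_lim_const.
      - apply is_derive_Reals; auto_derive; [trivial | field; lra]. }
    assert (h2 : is_derive (fun y => / sqrt t * exp (- (y + mu * t) ^ 2 / (2 * t))) x
      (- ((x + mu * t) / t) * (/ sqrt t * exp (- (x + mu * t) ^ 2 / (2 * t))))).
    { pose proof (sqrt_lt_R0 t ht). auto_derive; [trivial|].
      replace (- ((x + mu * t) * ((x + mu * t) * 1)) * / (2 * t))
        with (- (x + mu * t) ^ 2 / (2 * t)) by (unfold Rdiv; simpl; ring).
      field; lra. }
    apply (is_derive_mult_eq _ _ _ _ _ _ h2 h1).
    pose proof (sqrt_lt_R0 t ht); field; repeat split; lra.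
  - apply (is_derive_plus _ _ x _ _ IH1 IH2).
  - apply (is_derive_mult _ _ x _ _ IH1 IH2 Rmult_comm).
Qed.

Lemma is_derive_eval_t (A K mu : R) (F : R -> R) (e : hexpr) (t x : R) :
  growth_by A K F -> 0 < t ->
  is_derive (fun s => eval mu F e s x) t (eval mu F (dt mu e) t x).
Proof.
  intros hF ht; induction e as [c| | |n|e1 IH1 e2 IH2|e1 IH1 e2 IH2]; simpl.
  - apply (is_derive_const c).
  - apply (is_derive_const x).
  - auto_derive; [lra | field; lra].
  - unfold heat_moment.
    pose proof (moment_differentiable A K F n _ ((x + mu * t) / t) hF (inv_2t_pos t ht)) as hm.
    assert (h1 : is_derive (fun s => moment n F (/ (2 * s)) ((x + mu * s) / s)) t
      (- moment (n + 2) F (/ (2 * t)) ((x + mu * t) / t) * (- / (2 * t ^ 2))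
        + moment (n + 1) F (/ (2 * t)) ((x + mu * t) / t) * (- x / t ^ 2))).
    { apply is_derive_Reals.
      apply (derivable_pt_lim_comp_2d (moment n F) (fun s => / (2 * s)) (fun s => (x + mu * s) / s)).
      - exact hm.
      - apply is_derive_Reals; auto_derive; [lra | field; lra].
      - apply is_derive_Reals; auto_derive; [lra | field; lra]. }
    assert (h2 : is_derive (fun s => / sqrt s * exp (- (x + mu * s) ^ 2 / (2 * s))) t
      ((- / (2 * t) + / 2 * ((x + mu * t) / t) ^ 2 - mu * ((x + mu * t) / t))
        * (/ sqrt t * exp (- (x + mu * t) ^ 2 / (2 * t))))).
    { pose proof (sqrt_lt_R0 t ht) as hs. auto_derive; [repeat split; lra|].
      replace (- ((x + mu * t) * ((x + mu * t) * 1)) * / (2 * t))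
        with (- (x + mu * t) ^ 2 / (2 * t)) by (unfold Rdiv; simpl; ring).
      set (E := exp _). assert (hq : sqrt t * sqrt t = t) by (apply sqrt_sqrt; lra).
      set (q := sqrt t) in *. rewrite <- hq. field; lra. }
    apply (is_derive_mult_eq _ _ _ _ _ _ h2 h1).
    pose proof (sqrt_lt_R0 t ht); field; repeat split; lra.
  - apply (is_derive_plus _ _ t _ _ IH1 IH2).
  - apply (is_derive_mult _ _ t _ _ IH1 IH2 Rmult_comm).
Qed.

Lemma continuity_eval (A K mu : R) (F : R -> R) (e : hexpr) (t x : R) :
  growth_by A K F -> 0 < t -> continuity_2d_pt (eval mu F e) t x.
Proof.
  intros hF ht.
  assert (ct : continuity_2d_pt (fun s _ => s) t x) by apply continuity_2d_pt_id1.
  assert (cx : continuity_2d_pt (fun _ y => y) t x) by apply continuity_2d_pt_id2.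
  assert (ci : continuity_2d_pt (fun s _ => / s) t x).
  { apply (continuity_2d_pt_inv (fun s _ => s)); [exact ct | lra]. }
  induction e as [c| | |n|e1 IH1 e2 IH2|e1 IH1 e2 IH2]; simpl; auto.
  - apply (continuity_2d_pt_const t x c).
  - assert (cX : continuity_2d_pt (fun s y => y + mu * s) t x).
    { apply (continuity_2d_pt_plus (fun _ y => y) (fun s _ => mu * s)); [exact cx|].
      apply (continuity_2d_pt_mult (fun _ _ => mu) (fun s _ => s)); [|exact ct].
      apply continuity_2d_pt_const. }
    assert (c2 : continuity_2d_pt (fun s _ => / (2 * s)) t x).
    { apply (continuity_1d_2d_pt_comp (fun s => / (2 * s)) (fun s _ => s)); [|exact ct].
      apply continuity_pt_filterlim, (ex_derive_continuous (fun s => / (2 * s))).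
      auto_derive; lra. }
    unfold heat_moment.
    apply (continuity_2d_pt_mult (fun s y => / sqrt s * exp (- (y + mu * s) ^ 2 / (2 * s)))
      (fun s y => moment n F (/ (2 * s)) ((y + mu * s) / s))).
    + apply (continuity_2d_pt_mult (fun s y => / sqrt s)
        (fun s y => exp (- (y + mu * s) ^ 2 / (2 * s)))).
      * apply (continuity_1d_2d_pt_comp (fun s => / sqrt s) (fun s _ => s)); [|exact ct].
        apply continuity_pt_filterlim, (ex_derive_continuous (fun s => / sqrt s)).
        pose proof (sqrt_lt_R0 t ht). auto_derive; lra.
      * apply (continuity_1d_2d_pt_comp exp); [apply derivable_continuous_pt, derivable_pt_exp|].
        apply (continuity_2d_pt_mult (fun s y => - (y + mu * s) ^ 2) (fun s y => / (2 * s)));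
          [|exact c2].
        apply (continuity_1d_2d_pt_comp (fun z => - z ^ 2)); [|exact cX].
        apply continuity_pt_filterlim, (ex_derive_continuous (fun z => - z ^ 2)).
        auto_derive; trivial.
    + apply (continuity_2d_pt_comp2 (moment n F) (fun s _ => / (2 * s)) (fun s y => (y + mu * s) / s)).
      * apply differentiable_continuity_pt. do 2 eexists.
        apply (moment_differentiable A K); [exact hF | now apply inv_2t_pos].
      * exact c2.
      * apply (continuity_2d_pt_mult (fun s y => y + mu * s) (fun s y => / s)); auto.
  - apply continuity_2d_pt_plus; auto.
  - apply continuity_2d_pt_mult; auto.
Qed.

Lemma continuity_2d_cont2_on (S : R -> R -> Prop) (u : R -> R -> R) :
  (forall t x, S t x -> continuity_2d_pt u t x) -> cont2_on S u.
Proof.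
  intros h t x hS eps he.
  destruct (h t x hS (mkposreal eps he)) as [d hd].
  exists d; split; [apply cond_pos | intros; now apply hd].
Qed.

Lemma Ck_Dom_eval (A K mu : R) (F : R -> R) (k : nat) (e : hexpr) :
  growth_by A K F -> Ck_Dom k (eval mu F e).
Proof.
  intros hF; revert e; induction k as [|k IH]; intros e; split; trivial.
  1,2: apply continuity_2d_cont2_on; intros t x [ht _]; now apply (continuity_eval A K).
  exists (eval mu F (dt mu e)), (eval mu F (dx mu e)); split; [|now split].
  intros t x [ht hx]; split; apply is_derive_within;
    [now apply (is_derive_eval_t A K) | now apply (is_derive_eval_x A K)].
Qed.

(** * Gaussian averages up to time zero *)

Ltac nonneg := unfold Rdiv;
  repeat first
    [ lra | assumption | apply pow2_ge_0 | apply Rabs_pos | apply sqrt_pos | apply Rlt_le, exp_pos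
    | apply Rlt_le, Rinv_0_lt_compat; lra | apply Rmult_le_pos ].

Definition gauss (z : R) : R := exp (- / 2 * z ^ 2).

(* The value [sqrt (2 * PI)] is never needed. *)
Definition gauss_mass : R := integral gauss.

(** The mean of [F] at time [t] along a Brownian motion with drift [mu] started at [x]. The kernel
    is independent of [t] and [x], so nothing degenerates as [t] tends to [0]. *)
Definition heat (mu : R) (F : R -> R) (t x : R) : R :=
  / gauss_mass * integral (fun z => gauss z * F (sqrt t * z + (x + mu * t))).

Lemma gauss_rapid_of_bound (A C : R) (H B : R -> R) :
  cont H -> (forall z, Rabs (H z) <= B z) ->
  (forall z, gauss z * B z <= C * exp (- Rabs z)) ->
  rapid_by C (fun z => gauss z * H z).
Proof.
  intros hc hb hB; split.
  - unfold gauss; cont_tac.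
  - intros z; eapply Rle_trans; [|apply hB].
    rewrite Rabs_mult, Rabs_pos_eq by apply Rlt_le, exp_pos.
    apply Rmult_le_compat_l; [apply Rlt_le, exp_pos | apply hb].
Qed.

Lemma gauss_poly_exp (n : nat) (K : R) :
  exists C, 0 <= C /\
    forall z, gauss z * (Rabs z ^ n * exp (K * Rabs z)) <= C * exp (- Rabs z).
Proof.
  destruct (gauss_bound n K (/ 2) ltac:(lra)) as [C [hC h]].
  exists C; split; [exact hC|]; intros z; eapply Rle_trans; [|apply (h z)].
  unfold gauss; apply Req_le.
  replace (K * Rabs z - / 2 * z ^ 2) with (- / 2 * z ^ 2 + K * Rabs z) by ring.
  rewrite exp_plus; ring.
Qed.

Lemma gauss_rapid : exists C, rapid_by C gauss.
Proof.
  destruct (gauss_poly_exp 0 0) as [C [hC h]]; exists C; split.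
  - unfold gauss; cont_tac.
  - intros z; eapply Rle_trans; [|apply (h z)]; rewrite Rmult_0_l, exp_0; simpl.
    rewrite Rabs_pos_eq by apply Rlt_le, exp_pos; lra.
Qed.

Lemma gauss_mass_pos : 0 < gauss_mass.
Proof.
  destruct gauss_rapid as [C h]; apply (integral_pos C); [exact h | intros; apply exp_pos].
Qed.

(** Growth occurs only to the left, so a lower bound on the centre [p] suffices. This is the source
    of all uniformity over the unbounded range of [x]. *)
Lemma growth_by_affine (A K : R) (F : R -> R) (b p M B z : R) :
  growth_by A K F -> 0 <= b <= B -> 0 <= M -> - M <= p ->
  Rabs (F (b * z + p)) <= A * exp (K * M) * exp (K * B * Rabs z).
Proof.
  intros hF hb hM hp; pose proof (growth_by_nonneg A K F hF) as hA.
  destruct hF as (_ & hK & h).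
  eapply Rle_trans; [apply h|]; rewrite Rmult_assoc, <- exp_plus.
  apply Rmult_le_compat_l; [exact hA|]; apply exp_le_compat.
  replace (K * M + K * B * Rabs z) with (K * (M + B * Rabs z)) by ring.
  apply Rmult_le_compat_l; [exact hK|].
  pose proof (Rabs_pos z); pose proof (Rle_abs (- z)) as hz; rewrite Rabs_Ropp in hz.
  apply Rmax_lub; nra.
Qed.

(** One constant serves the whole strip: the centre [x + mu * t] stays above [- Rabs mu * T] and the
    dilation [sqrt t] below [sqrt T]. *)
Lemma heat_density_rapid (A K mu : R) (F : R -> R) (T : R) : growth_by A K F -> 0 <= T ->
  exists C, forall t x, 0 <= t <= T -> 0 <= x ->
    rapid_by C (fun z => gauss z * F (sqrt t * z + (x + mu * t))).
Proof.
  intros hF hT; pose proof (growth_by_nonneg A K F hF) as hA.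
  destruct (gauss_poly_exp 0 (K * sqrt T)) as [C [hC h]].
  set (M := Rabs mu * T).
  assert (hM : 0 <= M) by (apply Rmult_le_pos; [apply Rabs_pos | exact hT]).
  exists (A * exp (K * M) * C); intros t x ht hx.
  apply (gauss_rapid_of_bound A _ _ (fun z => A * exp (K * M) * exp (K * sqrt T * Rabs z))).
  - destruct hF as [hc _]; apply (cont_comp F (fun z => sqrt t * z + (x + mu * t))); cont_tac.
  - intros z; apply growth_by_affine; auto.
    + split; [apply sqrt_pos | apply sqrt_le_1_alt; lra].
    + pose proof (Rle_abs (- mu)) as hmu; rewrite Rabs_Ropp in hmu.
      pose proof (Rabs_pos mu). unfold M; nra.
  - intros z; specialize (h z); simpl in h; rewrite Rmult_1_l in h.
    replace (gauss z * (A * exp (K * M) * exp (K * sqrt T * Rabs z)))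
      with (A * exp (K * M) * (gauss z * exp (K * sqrt T * Rabs z))) by ring.
    rewrite (Rmult_assoc (A * exp (K * M)) C); apply Rmult_le_compat_l; [|exact h].
    apply Rmult_le_pos; [exact hA | apply Rlt_le, exp_pos].
Qed.

Lemma heat_bounded (A K mu : R) (F : R -> R) (T : R) : growth_by A K F -> 0 <= T ->
  bdd2_on (strip T) (heat mu F).
Proof.
  intros hF hT; destruct (heat_density_rapid A K mu F T hF hT) as [C h].
  exists (/ gauss_mass * (2 * C)); intros t x [ht hx].
  pose proof (Rinv_0_lt_compat _ gauss_mass_pos) as hi.
  unfold heat; rewrite Rabs_mult, Rabs_pos_eq by lra.
  apply Rmult_le_compat_l; [lra|]; apply integral_bound, h; auto.
Qed.

Lemma heat_affine (A K mu : R) (F : R -> R) (c t x : R) : growth_by A K F ->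
  0 <= t -> 0 <= x ->
  exists C, rapid_by C (fun z => gauss z * (F (sqrt t * z + (x + mu * t)) - c)) /\
  heat mu F t x - c
    = / gauss_mass * integral (fun z => gauss z * (F (sqrt t * z + (x + mu * t)) - c)).
Proof.
  intros hF ht hx.
  destruct (heat_density_rapid A K mu F t hF ht) as [C h]; specialize (h t x ltac:(lra) hx).
  destruct gauss_rapid as [D hD].
  pose proof (rapid_by_lin _ _ 1 (- c) _ _ h hD) as r.
  assert (e : forall z, gauss z * (F (sqrt t * z + (x + mu * t)) - c)
    = 1 * (gauss z * F (sqrt t * z + (x + mu * t))) + - c * gauss z) by (intros; ring).
  eexists; split.
  - destruct r as [r1 r2]; split.
    + intros y; apply (continuous_ext _ _ y (fun z => eq_sym (e z))), r1.
    + intros y; rewrite e; apply r2.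
  - rewrite (integral_ext _ _ e), (integral_lin _ _ 1 (- c) _ _ h hD).
    unfold heat; fold gauss_mass. pose proof gauss_mass_pos; field; lra.
Qed.

Lemma heat_0 (A K mu : R) (F : R -> R) (x : R) : growth_by A K F -> 0 <= x ->
  heat mu F 0 x = F x.
Proof.
  intros hF hx; destruct (heat_affine A K mu F (F x) 0 x hF (Rle_refl 0) hx) as [C [_ e]].
  rewrite (integral_ext _ (fun z => 0 * gauss z)) in e.
  - destruct gauss_rapid as [D hD]; rewrite (integral_scal D) in e by exact hD; lra.
  - intros z; rewrite sqrt_0; replace (0 * z + (x + mu * 0)) with x by ring; ring.
Qed.

(** Constants are reproduced by the average, so closeness to [c] reduces to a majorant [B] of the
    deviation of [F] from [c] in the standardised variable. Both limits, at [t = 0] and at infinity,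
    are obtained from it. *)
Lemma heat_near (A K mu : R) (F B : R -> R) (c C t x : R) : growth_by A K F ->
  0 <= t -> 0 <= x ->
  (forall z, Rabs (F (sqrt t * z + (x + mu * t)) - c) <= B z) ->
  (forall z, gauss z * B z <= C * exp (- Rabs z)) ->
  Rabs (heat mu F t x - c) <= / gauss_mass * (2 * C).
Proof.
  intros hF ht hx hb hB; destruct (heat_affine A K mu F c t x hF ht hx) as [D [hD ->]].
  pose proof (Rinv_0_lt_compat _ gauss_mass_pos) as hi.
  rewrite Rabs_mult, Rabs_pos_eq by lra.
  apply Rmult_le_compat_l; [lra|]; apply integral_bound.
  apply (gauss_rapid_of_bound A C _ B); auto.
  destruct hF as [hc _]; apply cont_minus; [|apply cont_const].
  apply (cont_comp F (fun z => sqrt t * z + (x + mu * t))); cont_tac.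
Qed.

(** A Chebyshev argument: within distance [d] of [x0] the deviation of [F] is at most [e1], and
    beyond it the factor [(y - x0) ^ 2 / d ^ 2 >= 1] may be inserted. The average of that quadratic,
    even with exponential growth, is of order [t + h ^ 2], where [h] is the offset of the centre
    from [x0]. *)
Lemma heat_cont_0 (A K mu : R) (F : R -> R) (x0 : R) : growth_by A K F -> 0 <= x0 ->
  forall eps, 0 < eps -> exists delta, 0 < delta /\
    forall t x, 0 <= t < delta -> 0 <= x -> Rabs (x - x0) < delta ->
      Rabs (heat mu F t x - F x0) < eps.
Proof.
  intros hF hx0 eps he; pose proof (growth_by_nonneg A K F hF) as hA.
  assert (hK : 0 <= K) by apply hF.
  pose proof (Rinv_0_lt_compat _ gauss_mass_pos) as hi; set (ci := / gauss_mass) in *.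
  destruct (gauss_poly_exp 0 0) as [C0 [hC0 h0]].
  destruct (gauss_poly_exp 0 K) as [C1 [hC1 h1]].
  destruct (gauss_poly_exp 2 K) as [C2 [hC2 h2]].
  (* The uniformly small part of the deviation contributes [2 * ci * C0 * e1], strictly less than
     [eps / 2]. *)
  set (e1 := eps / (4 * (ci * C0 + 1))).
  assert (hcC : 0 <= ci * C0) by (apply Rmult_le_pos; lra).
  assert (he1 : 0 < e1) by (apply Rdiv_lt_0_compat; lra).
  assert (hc := proj1 hF x0).
  apply continuity_pt_filterlim in hc.
  destruct (hc e1 he1) as [d [hd hcd]].
  simpl in hcd; unfold Rdist, D_x, no_cond in hcd.
  set (B := 2 * A * exp (K * Rabs x0) / d ^ 2 * exp K).
  assert (hd2 : 0 < d ^ 2) by (apply pow_lt; lra).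
  assert (hB : 0 <= B).
  { unfold B; nonneg. }
  assert (hF' : forall y, Rabs (F y - F x0) <=
    e1 + 2 * A * exp (K * Rabs x0) / d ^ 2 * (y - x0) ^ 2 * exp (K * Rabs (y - x0))).
  { intros y; set (Z := exp (K * Rabs (y - x0))).
    assert (hZ : 1 <= Z).
    { rewrite <- exp_0; apply exp_le_compat, Rmult_le_pos; [exact hK | apply Rabs_pos]. }
    pose proof (exp_pos (K * Rabs x0)) as hp.
    destruct (Rlt_le_dec (Rabs (y - x0)) d) as [hy|hy].
    - assert (Rabs (F y - F x0) < e1).
      { destruct (Req_dec x0 y) as [->|hne].
        - rewrite Rminus_diag, Rabs_R0; exact he1.
        - apply hcd; auto. }
      assert (0 <= 2 * A * exp (K * Rabs x0) / d ^ 2 * (y - x0) ^ 2 * Z); [|lra].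
      nonneg.
    - assert (g1 : Rabs (F y) <= A * (exp (K * Rabs x0) * Z)).
      { eapply Rle_trans; [apply (growth_by_abs A K F y hF)|].
        apply Rmult_le_compat_l; [exact hA|]; unfold Z; rewrite <- exp_plus.
        apply exp_le_compat; rewrite <- Rmult_plus_distr_l.
        apply Rmult_le_compat_l; [exact hK|].
        replace y with (x0 + (y - x0)) at 1 by ring; apply Rabs_triang. }
      assert (g2 : Rabs (F x0) <= A * (exp (K * Rabs x0) * Z)).
      { eapply Rle_trans; [apply (growth_by_abs A K F x0 hF)|].
        apply Rmult_le_compat_l; [exact hA|]; nra. }
      apply Rle_trans with (2 * A * exp (K * Rabs x0) * Z).
      { eapply Rle_trans; [apply Rabs_triang|]; rewrite Rabs_Ropp; lra. }
      apply Rle_trans with (2 * A * exp (K * Rabs x0) * Z * ((y - x0) ^ 2 / d ^ 2)).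
      + rewrite <- (Rmult_1_r (2 * A * exp (K * Rabs x0) * Z)) at 1.
        apply Rmult_le_compat_l; [nonneg|].
        apply Rmult_le_reg_r with (d ^ 2); [exact hd2|].
        replace ((y - x0) ^ 2 / d ^ 2 * d ^ 2) with ((y - x0) ^ 2) by (field; lra).
        rewrite <- (pow2_abs (y - x0)), Rmult_1_l; apply pow_incr; lra.
      + apply Rle_trans with (0 + 2 * A * exp (K * Rabs x0) * Z * ((y - x0) ^ 2 / d ^ 2)); [lra|].
        apply Rplus_le_compat; [lra|]; apply Req_le; field; lra. }
  set (Q := ci * (4 * B * ((2 + Rabs mu) * (C1 + C2)))).
  assert (hQ : 0 <= Q).
  { pose proof (Rabs_pos mu). unfold Q; nonneg. }
  (* The first bound forces [Rabs h <= 1] and [t <= 1], so that the exponential factors stay under a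
     fixed majorant; the second keeps the quadratic contribution [dl * Q] below [eps / 2]. *)
  set (dl := Rmin (/ (1 + Rabs mu)) (eps / (2 * (Q + 1)))).
  assert (hmu : 0 <= Rabs mu) by apply Rabs_pos.
  assert (hdl : 0 < dl).
  { apply Rmin_glb_lt; [apply Rinv_0_lt_compat; lra | apply Rdiv_lt_0_compat; lra]. }
  assert (hdl1 : dl * (1 + Rabs mu) <= 1).
  { apply Rle_trans with (/ (1 + Rabs mu) * (1 + Rabs mu)).
    - apply Rmult_le_compat_r; [lra | apply Rmin_l].
    - apply Req_le, Rinv_l; lra. }
  assert (hdl2 : dl * (Q + 1) <= eps / 2).
  { apply Rle_trans with (eps / (2 * (Q + 1)) * (Q + 1)).
    - apply Rmult_le_compat_r; [lra | apply Rmin_r].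
    - apply Req_le; field; lra. }
  exists dl; split; [exact hdl|]; intros t x ht hx hxx.
  set (h := x + mu * t - x0).
  assert (hh1 : Rabs h <= Rabs (x - x0) + Rabs mu * t).
  { unfold h; replace (x + mu * t - x0) with ((x - x0) + mu * t) by ring.
    eapply Rle_trans; [apply Rabs_triang|]; rewrite Rabs_mult, (Rabs_pos_eq t) by lra; lra. }
  assert (hh2 : Rabs h <= dl * (1 + Rabs mu)) by nra.
  assert (hh3 : h ^ 2 <= dl * (1 + Rabs mu)).
  { rewrite <- pow2_abs; pose proof (Rabs_pos h); nra. }
  set (s := sqrt t).
  assert (hs0 : 0 <= s) by apply sqrt_pos.
  assert (hs2 : s ^ 2 = t) by (unfold s; simpl; rewrite Rmult_1_r; apply sqrt_sqrt; lra).
  assert (hs1 : s <= 1).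
  { unfold s; rewrite <- sqrt_1; apply sqrt_le_1_alt. nra. }
  eapply Rle_lt_trans.
  { apply (heat_near A K mu F
      (fun z => e1 + B * (2 * h ^ 2 + 2 * t * Rabs z ^ 2) * exp (K * Rabs z))
      (F x0) (e1 * C0 + B * (2 * h ^ 2 * C1 + 2 * t * C2)) t x hF); try lra.
    - intros z; eapply Rle_trans; [apply hF'|]; apply Rplus_le_compat_l.
      fold s; replace (s * z + (x + mu * t) - x0) with (s * z + h) by (unfold h; ring).
      assert (hz : Rabs (s * z + h) <= 1 + Rabs z).
      { eapply Rle_trans; [apply Rabs_triang|]; rewrite Rabs_mult, (Rabs_pos_eq s) by lra.
        pose proof (Rabs_pos z); nra. }
      assert (hE : exp (K * Rabs (s * z + h)) <= exp K * exp (K * Rabs z)).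
      { rewrite <- exp_plus; apply exp_le_compat; nra. }
      assert (hsq : (s * z + h) ^ 2 <= 2 * h ^ 2 + 2 * t * Rabs z ^ 2).
      { rewrite pow2_abs, <- hs2. pose proof (pow2_ge_0 (s * z - h)); nra. }
      set (P := 2 * A * exp (K * Rabs x0) / d ^ 2) in *.
      assert (hP : 0 <= P).
      { unfold P; nonneg. }
      unfold B; fold P.
      replace (P * exp K * (2 * h ^ 2 + 2 * t * Rabs z ^ 2) * exp (K * Rabs z))
        with (P * (2 * h ^ 2 + 2 * t * Rabs z ^ 2) * (exp K * exp (K * Rabs z))) by ring.
      apply Rmult_le_compat; [| apply Rlt_le, exp_pos | | exact hE].
      + apply Rmult_le_pos; [exact hP | apply pow2_ge_0].
      + apply Rmult_le_compat_l; [exact hP | exact hsq].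
    - intros z; specialize (h0 z); specialize (h1 z); specialize (h2 z).
      rewrite Rmult_0_l, exp_0 in h0.
      change (Rabs z ^ 0) with 1 in h0, h1.
      set (E := exp (K * Rabs z)) in *. set (G := gauss z) in *. set (X := exp (- Rabs z)) in *.
      replace (G * (e1 + B * (2 * h ^ 2 + 2 * t * Rabs z ^ 2) * E)) with
        (e1 * (G * (1 * 1)) + B * (2 * h ^ 2) * (G * (1 * E)) + B * (2 * t) * (G * (Rabs z ^ 2 * E)))
        by ring.
      replace ((e1 * C0 + B * (2 * h ^ 2 * C1 + 2 * t * C2)) * X) with
        (e1 * (C0 * X) + B * (2 * h ^ 2) * (C1 * X) + B * (2 * t) * (C2 * X)) by ring.
      pose proof (pow2_ge_0 h).
      repeat apply Rplus_le_compat; apply Rmult_le_compat_l; try assumption; try lra;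
        apply Rmult_le_pos; lra. }
  fold ci.
  assert (i1 : ci * (2 * (e1 * C0)) < eps / 2).
  { replace (ci * (2 * (e1 * C0))) with (eps / 2 * (ci * C0 / (ci * C0 + 1)))
      by (unfold e1; field; lra).
    rewrite <- (Rmult_1_r (eps / 2)) at 2. apply Rmult_lt_compat_l; [lra|].
    apply Rmult_lt_reg_r with (ci * C0 + 1); [lra|].
    replace (ci * C0 / (ci * C0 + 1) * (ci * C0 + 1)) with (ci * C0) by (field; lra). lra. }
  assert (i2 : ci * (2 * (B * (2 * h ^ 2 * C1 + 2 * t * C2))) <= dl * Q).
  { assert (2 * h ^ 2 * C1 + 2 * t * C2 <= 2 * (dl * ((2 + Rabs mu) * (C1 + C2)))).
    { assert (h ^ 2 * C1 <= dl * (2 + Rabs mu) * C1) by (apply Rmult_le_compat_r; nra).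
      assert (t * C2 <= dl * (2 + Rabs mu) * C2) by (apply Rmult_le_compat_r; nra). lra. }
    apply Rle_trans with (ci * (2 * (B * (2 * (dl * ((2 + Rabs mu) * (C1 + C2))))))).
    - repeat (apply Rmult_le_compat_l; [lra|]); assumption.
    - apply Req_le; unfold Q; ring. }
  nra.
Qed.

(** Beyond some [Y] the function is small; to fall below [Y] the variable must satisfy
    [D <= s * Rabs z], where [D] is the distance from the centre down to [Y]. Inserting the factor
    [s / D * Rabs z >= 1] there gives a contribution of order [/ D]. *)
Lemma heat_tends_to_0 (A K mu : R) (F : R -> R) (t : R) : growth_by A K F -> 0 <= t ->
  tends_to_0_at_infty F -> tends_to_0_at_infty (heat mu F t).
Proof.
  intros hF ht hlim eps he; pose proof (growth_by_nonneg A K F hF) as hA.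
  assert (hK : 0 <= K) by apply hF.
  pose proof (Rinv_0_lt_compat _ gauss_mass_pos) as hi; set (ci := / gauss_mass) in *.
  set (s := sqrt t); assert (hs0 : 0 <= s) by apply sqrt_pos.
  destruct (gauss_poly_exp 0 0) as [C0 [hC0 h0]].
  destruct (gauss_poly_exp 1 (K * s)) as [C1 [hC1 h1]].
  set (e1 := eps / (4 * (ci * C0 + 1))).
  assert (hcC : 0 <= ci * C0) by (apply Rmult_le_pos; lra).
  assert (he1 : 0 < e1) by (apply Rdiv_lt_0_compat; lra).
  destruct (hlim e1 he1) as [Y hY].
  set (M := Rabs mu * t); assert (hM : 0 <= M) by (apply Rmult_le_pos; [apply Rabs_pos | lra]).
  set (A' := A * exp (K * M)).
  assert (hA' : 0 <= A') by (apply Rmult_le_pos; [lra | apply Rlt_le, exp_pos]).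
  set (Q := ci * (2 * (A' * (s * C1)))).
  assert (hQ : 0 <= Q) by (unfold Q; nonneg).
  assert (hmt : - M <= mu * t).
  { unfold M; pose proof (Rle_abs (- mu)) as hmu; rewrite Rabs_Ropp in hmu; nra. }
  (* [D >= N] makes the far contribution [Q / D] at most [eps / 2]; the summand [1] keeps [D]
     positive when [Q] vanishes. *)
  set (N := 2 * Q / eps + 1).
  assert (hN0 : 0 <= 2 * Q / eps) by (apply Rmult_le_pos; [lra | apply Rlt_le, Rinv_0_lt_compat; lra]).
  exists (Rmax 0 (Y + M + N)); intros x hx.
  pose proof (Rmax_l 0 (Y + M + N)); pose proof (Rmax_r 0 (Y + M + N)).
  set (D := x + mu * t - Y).
  assert (hD : N <= D) by (unfold D; lra).
  assert (hD0 : 0 < D) by (unfold N in hD; lra).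
  rewrite <- (Rminus_0_r (heat mu F t x)).
  eapply Rle_lt_trans.
  { apply (heat_near A K mu F (fun z => e1 + A' * (s / D * Rabs z) * exp (K * s * Rabs z))
      0 (e1 * C0 + A' * (s / D) * C1) t x hF); try lra.
    - intros z; rewrite Rminus_0_r; fold s.
      assert (hT : 0 <= A' * (s / D * Rabs z) * exp (K * s * Rabs z)).
      { nonneg. }
      destruct (Rle_lt_dec Y (s * z + (x + mu * t))) as [hy|hy].
      + specialize (hY _ hy); lra.
      + assert (hz : D <= s * Rabs z).
        { pose proof (Rle_abs (- z)) as hz; rewrite Rabs_Ropp in hz. unfold D; nra. }
        apply Rle_trans with (A' * exp (K * s * Rabs z)).
        * unfold A'; apply growth_by_affine; auto; lra.
        * apply Rle_trans with (0 + A' * (s / D * Rabs z) * exp (K * s * Rabs z)); [|lra].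
          rewrite Rplus_0_l; apply Rmult_le_compat_r; [apply Rlt_le, exp_pos|].
          rewrite <- (Rmult_1_r A') at 1; apply Rmult_le_compat_l; [exact hA'|].
          apply Rmult_le_reg_r with D; [exact hD0|].
          replace (s / D * Rabs z * D) with (s * Rabs z) by (field; lra). lra.
    - intros z; specialize (h0 z); specialize (h1 z).
      rewrite Rmult_0_l, exp_0 in h0; rewrite pow_1 in h1; change (Rabs z ^ 0) with 1 in h0.
      set (E := exp (K * s * Rabs z)) in *. set (G := gauss z) in *. set (X := exp (- Rabs z)) in *.
      replace (G * (e1 + A' * (s / D * Rabs z) * E)) with
        (e1 * (G * (1 * 1)) + A' * (s / D) * (G * (Rabs z * E))) by ring.
      replace ((e1 * C0 + A' * (s / D) * C1) * X) with
        (e1 * (C0 * X) + A' * (s / D) * (C1 * X)) by ring.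
      apply Rplus_le_compat; apply Rmult_le_compat_l; try assumption; try lra.
      nonneg. }
  fold ci.
  assert (i1 : ci * (2 * (e1 * C0)) < eps / 2).
  { replace (ci * (2 * (e1 * C0))) with (eps / 2 * (ci * C0 / (ci * C0 + 1)))
      by (unfold e1; field; lra).
    rewrite <- (Rmult_1_r (eps / 2)) at 2. apply Rmult_lt_compat_l; [lra|].
    apply Rmult_lt_reg_r with (ci * C0 + 1); [lra|].
    replace (ci * C0 / (ci * C0 + 1) * (ci * C0 + 1)) with (ci * C0) by (field; lra). lra. }
  assert (i2 : ci * (2 * (A' * (s / D) * C1)) <= eps / 2).
  { replace (ci * (2 * (A' * (s / D) * C1))) with (Q / D) by (unfold Q; field; lra).
    apply Rmult_le_reg_r with D; [exact hD0|].
    replace (Q / D * D) with Q by (field; lra).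
    apply Rle_trans with (eps / 2 * N); [|apply Rmult_le_compat_l; lra].
    unfold N; replace (eps / 2 * (2 * Q / eps + 1)) with (Q + eps / 2) by (field; lra). lra. }
  lra.
Qed.

(** * The heat equation and integration by parts *)

Lemma has_deriv_within_ext (S : R -> Prop) (g h : R -> R) (x l : R) :
  S x -> (forall y, S y -> g y = h y) ->
  has_deriv_within S g x l -> has_deriv_within S h x l.
Proof.
  intros hx e hg eps he; destruct (hg eps he) as [d [hd H]].
  exists d; split; [exact hd|]; intros k hk hkd hS.
  rewrite <- !e by assumption; now apply H.
Qed.

Lemma cont2_on_ext (S : R -> R -> Prop) (u v : R -> R -> R) :
  (forall t x, S t x -> u t x = v t x) -> cont2_on S u -> cont2_on S v.
Proof.
  intros e hu t x hS eps he; destruct (hu t x hS eps he) as [d [hd H]].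
  exists d; split; [exact hd|]; intros t' x' hS' h1 h2.
  rewrite <- !e by assumption; now apply H.
Qed.

Lemma pd_ext_Dom (u v : R -> R -> R) (t x a b : R) :
  (forall t x, Dom t x -> u t x = v t x) -> Dom t x ->
  pd_t u t x a /\ pd_x u t x b -> pd_t v t x a /\ pd_x v t x b.
Proof.
  intros e [ht hx] [h1 h2]; split.
  - apply (has_deriv_within_ext _ (fun s => u s x)); auto. intros s hs; now apply e.
  - apply (has_deriv_within_ext _ (fun y => u t y)); auto. intros y hy; now apply e.
Qed.

(** Only the outermost level changes: the partial derivatives that witness the regularity of [u]
    serve for [v]. *)
Lemma Ck_Dom_ext (k : nat) (u v : R -> R -> R) :
  (forall t x, Dom t x -> u t x = v t x) -> Ck_Dom k u -> Ck_Dom k v.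
Proof.
  intros e; destruct k as [|k]; intros [hc h]; split; try exact I;
    try (now apply (cont2_on_ext _ u)).
  destruct h as (ut & ux & hd & h); exists ut, ux; split; [|exact h].
  intros t x hD; apply (pd_ext_Dom u); auto.
Qed.

Definition heat_expr : hexpr := Mul (Const (/ gauss_mass)) (Moment 0).

(** The substitution [y = sqrt t * z + X] links the two forms of the average; the constant [c]
    collects its Jacobian and the factor [exp (X ^ 2 / (2 * t))] left by completing the square. *)
Lemma heat_eval (A K mu : R) (F : R -> R) (t x : R) : growth_by A K F -> 0 < t -> 0 <= x ->
  heat mu F t x = eval mu F heat_expr t x.
Proof.
  intros hF ht hx; simpl; unfold heat, heat_moment; f_equal.
  set (X := x + mu * t).
  pose proof (sqrt_lt_R0 t ht) as hs.
  set (c := sqrt t * exp (X ^ 2 / (2 * t))).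
  destruct (moment_density_rapid A K F 0 (/ (2 * t)) (X / t) hF (inv_2t_pos t ht)) as [C hC].
  destruct (heat_density_rapid A K mu F t hF (Rlt_le _ _ ht)) as [D hD].
  specialize (hD t x ltac:(lra) hx); fold X in hD.
  assert (e : forall z, c * (gauss z * F (sqrt t * z + X))
    = sqrt t * moment_density 0 (/ (2 * t)) (X / t) F (sqrt t * z + X)).
  { intros z; unfold c, moment_density, gauss; simpl (_ ^ 0).
    replace (X / t * (sqrt t * z + X) - / (2 * t) * (sqrt t * z + X) ^ 2)
      with (X ^ 2 / (2 * t) + - / 2 * z ^ 2).
    - rewrite exp_plus; ring.
    - assert (hq : sqrt t * sqrt t = t) by (apply sqrt_sqrt; lra).
      set (q := sqrt t) in *; rewrite <- hq; field; lra. }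
  pose proof (rapid_by_lin _ _ c 0 _ _ hD hD) as r.
  assert (e' : forall z, c * (gauss z * F (sqrt t * z + X)) + 0 * (gauss z * F (sqrt t * z + X))
    = sqrt t * moment_density 0 (/ (2 * t)) (X / t) F (sqrt t * z + X))
    by (intros z; rewrite <- e; ring).
  unfold moment; rewrite <- (integral_affine C (Rabs c * D + Rabs 0 * D) X (sqrt t)
    (moment_density 0 (/ (2 * t)) (X / t) F)); auto.
  - rewrite <- (integral_ext _ _ e), (integral_scal D) by exact hD.
    unfold c; replace (- X ^ 2 / (2 * t)) with (- (X ^ 2 / (2 * t))) by (field; lra).
    rewrite exp_Ropp; field; pose proof (exp_pos (X ^ 2 / (2 * t))); lra.
  - split.
    + intros y; apply (continuous_ext _ _ y e'), r.
    + intros y; rewrite <- e'; apply r.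
Qed.

(** The three terms are the integral of the derivative of [exp (r * y - s * y ^ 2) * F y], which
    decays at both ends. *)
Lemma moment_by_parts (A K B L : R) (F W : R -> R) (s r : R) :
  growth_by A K F -> growth_by B L W -> (forall y, is_derive F y (W y)) -> 0 < s ->
  r * moment 0 F s r - 2 * s * moment 1 F s r + moment 0 W s r = 0.
Proof.
  intros hF hW hd hs.
  destruct (moment_density_rapid A K F 0 s r hF hs) as [C0 h0].
  destruct (moment_density_rapid A K F 1 s r hF hs) as [C1 h1].
  destruct (moment_density_rapid B L W 0 s r hW hs) as [C2 h2].
  pose proof (rapid_by_lin _ _ r (- (2 * s)) _ _ h0 h1) as h01.
  pose proof (rapid_by_lin _ _ 1 1 _ _ h01 h2) as h012.
  pose proof (integral_lin _ _ 1 1 _ _ h01 h2) as e.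
  rewrite (integral_lin _ _ r (- (2 * s)) _ _ h0 h1) in e.
  unfold moment.
  match goal with |- ?l = 0 => replace l with
    (1 * (r * integral (moment_density 0 s r F) + - (2 * s) * integral (moment_density 1 s r F))
      + 1 * integral (moment_density 0 s r W)) by ring end.
  rewrite <- e.
  apply (integral_derivative C0 (moment_density 0 s r F)); [|apply h012|exact h0].
  intros y; unfold moment_density.
  assert (g : is_derive (fun z => z ^ 0 * exp (r * z - s * z ^ 2)) y
    ((r - 2 * s * y) * exp (r * y - s * y ^ 2))).
  { auto_derive; [trivial|].
    replace (r * y + - (s * (y * (y * 1)))) with (r * y - s * y ^ 2) by ring. ring. }
  apply (is_derive_mult_eq _ _ _ _ _ _ g (hd y)); simpl; ring.
Qed.

(** The symbolic derivative falls on the kernel; integration by parts at [s = / (2 * t)],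
    [r = (x + mu * t) / t] transfers it to the data. *)
Lemma eval_dx_heat (A K B L mu : R) (F W : R -> R) (t x : R) :
  growth_by A K F -> growth_by B L W -> (forall y, is_derive F y (W y)) -> 0 < t ->
  eval mu F (dx mu heat_expr) t x = eval mu W heat_expr t x.
Proof.
  intros hF hW hd ht; simpl; unfold heat_moment.
  pose proof (moment_by_parts A K B L F W (/ (2 * t)) ((x + mu * t) / t) hF hW hd
    (inv_2t_pos t ht)) as e.
  replace (moment 0 W (/ (2 * t)) ((x + mu * t) / t))
    with (2 * / (2 * t) * moment 1 F (/ (2 * t)) ((x + mu * t) / t)
          - (x + mu * t) / t * moment 0 F (/ (2 * t)) ((x + mu * t) / t)) by lra.
  pose proof (sqrt_lt_R0 t ht); pose proof gauss_mass_pos; field; repeat split; lra.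
Qed.

(** The kernel itself solves the equation, so this is a polynomial identity in the moments with
    [/ t] as a free symbol. *)
Lemma eval_heat_equation (mu : R) (F : R -> R) (t x : R) :
  eval mu F (dt mu heat_expr) t x
  = mu * eval mu F (dx mu heat_expr) t x + / 2 * eval mu F (dx mu (dx mu heat_expr)) t x.
Proof. simpl; generalize (/ t) (/ gauss_mass); intros i c; field. Qed.

Lemma eval_dxx_heat (A K B L mu : R) (F W : R -> R) (t x : R) :
  growth_by A K F -> growth_by B L W -> (forall y, is_derive F y (W y)) -> 0 < t ->
  eval mu F (dx mu (dx mu heat_expr)) t x = eval mu W (dx mu heat_expr) t x.
Proof.
  intros hF hW hd ht.
  rewrite <- (is_derive_unique _ _ _ (is_derive_eval_x A K mu F (dx mu heat_expr) t x hF ht)).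
  apply is_derive_unique.
  apply (is_derive_ext (fun y => eval mu W heat_expr t y)).
  - intros y; symmetry; now apply (eval_dx_heat A K B L).
  - now apply (is_derive_eval_x B L).
Qed.

Lemma heat_cont_strip (A K mu : R) (F : R -> R) (T : R) : growth_by A K F ->
  cont2_on (strip T) (heat mu F).
Proof.
  intros hF t x [[ht htT] hx] eps he.
  destruct (Req_dec t 0) as [->|hne].
  - destruct (heat_cont_0 A K mu F x hF hx eps he) as [d [hd H]].
    exists d; split; [exact hd|]; intros t' x' [[ht' _] hx'] h1 h2.
    rewrite (heat_0 A K) by assumption; apply H; auto.
    rewrite Rminus_0_r, Rabs_pos_eq in h1; lra.
  - assert (ht0 : 0 < t) by lra.
    destruct (continuity_eval A K mu F heat_expr t x hF ht0 (mkposreal eps he)) as [d H].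
    pose proof (cond_pos d) as hd0.
    exists (Rmin d t); split; [now apply Rmin_glb_lt|].
    intros t' x' [[ht' _] hx'] h1 h2.
    pose proof (Rmin_l d t); pose proof (Rmin_r d t).
    assert (0 < t') by (pose proof (Rabs_def2 _ _ h1); lra).
    rewrite !(heat_eval A K) by assumption; apply H; lra.
Qed.

(** * Derivatives relative to the half-line *)

Lemma has_deriv_within_interior (S : R -> Prop) (g : R -> R) (x l : R) :
  (forall y, 0 < y -> S y) -> 0 < x -> has_deriv_within S g x l -> is_derive g x l.
Proof.
  intros hS hx h; apply is_derive_Reals; intros eps he.
  destruct (h eps he) as [d [hd H]].
  assert (hm : 0 < Rmin d x) by now apply Rmin_glb_lt.
  exists (mkposreal _ hm); simpl; intros k hk hkd.
  pose proof (Rmin_l d x); pose proof (Rmin_r d x).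
  apply H; [exact hk | lra | apply hS; pose proof (Rabs_def2 _ _ hkd); lra].
Qed.

Lemma has_deriv_within_minus (S : R -> Prop) (g h : R -> R) (x a b : R) :
  has_deriv_within S g x a -> has_deriv_within S h x b ->
  has_deriv_within S (fun y => g y - h y) x (a - b).
Proof.
  intros hg hh eps he.
  destruct (hg (eps / 2) ltac:(lra)) as [d1 [hd1 H1]].
  destruct (hh (eps / 2) ltac:(lra)) as [d2 [hd2 H2]].
  exists (Rmin d1 d2); split; [now apply Rmin_glb_lt|]; intros k hk hkd hS.
  pose proof (Rmin_l d1 d2); pose proof (Rmin_r d1 d2).
  specialize (H1 k hk ltac:(lra) hS); specialize (H2 k hk ltac:(lra) hS).
  replace ((g (x + k) - h (x + k) - (g x - h x)) / k - (a - b))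
    with (((g (x + k) - g x) / k - a) - ((h (x + k) - h x) / k - b)) by (field; exact hk).
  eapply Rle_lt_trans; [apply Rabs_triang|]; rewrite Rabs_Ropp; lra.
Qed.

(** The mean value theorem is applied to [g (Rabs z)], because it asks for two-sided continuity at
    the endpoint [0], where [g] is controlled from the right only. *)
Lemma has_deriv_within_zero_const (g : R -> R) :
  (forall x, 0 <= x -> has_deriv_within halfline g x 0) ->
  forall x, 0 <= x -> g x = g 0.
Proof.
  intros h x [hx|<-]; [|reflexivity].
  assert (hd : forall y, 0 < y -> is_derive (fun z => g (Rabs z)) y 0).
  { intros y hy; apply (is_derive_ext_loc g).
    - exists (mkposreal y hy); intros z hz.
      apply (Rabs_def2 (z - y)) in hz; simpl in hz; rewrite Rabs_pos_eq; [reflexivity | lra].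
    - apply (has_deriv_within_interior halfline); [apply Rlt_le | exact hy | apply h; lra]. }
  destruct (MVT_gen (fun z => g (Rabs z)) 0 x (fun _ => 0)) as [c [hc e]].
  - intros y hy; rewrite Rmin_left, Rmax_right in hy by lra; apply hd; lra.
  - intros y hy; rewrite Rmin_left, Rmax_right in hy by lra.
    destruct (proj1 hy) as [hy0|<-].
    + apply continuity_pt_filterlim, (ex_derive_continuous (fun z => g (Rabs z))).
      exists 0; now apply hd.
    (* Near [0] the difference quotient is below [1] in absolute value, so the increment of [g] is
       smaller than [Rabs z]. *)
    + intros eps he; destruct (h 0 (Rle_refl 0) 1 Rlt_0_1) as [d [hd0 H]].
      exists (Rmin d eps); split; [now apply Rmin_glb_lt|].
      intros z [[_ hne] hz]; simpl in *; unfold Rdist in *.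
      pose proof (Rmin_l d eps); pose proof (Rmin_r d eps).
      rewrite Rminus_0_r in hz; rewrite Rabs_R0.
      assert (hz0 : 0 < Rabs z) by (apply Rabs_pos_lt; lra).
      assert (hk : Rabs z <> 0) by lra.
      specialize (H (Rabs z) hk ltac:(rewrite Rabs_Rabsolu; lra)
        ltac:(unfold halfline; lra)).
      rewrite Rplus_0_l, Rminus_0_r in H; unfold Rdiv in H.
      rewrite Rabs_mult, (Rabs_pos_eq (/ Rabs z)) in H
        by now apply Rlt_le, Rinv_0_lt_compat.
      apply (Rmult_lt_compat_r (Rabs z) _ _ hz0) in H.
      rewrite Rmult_assoc, Rinv_l in H by exact hk; lra.
  - rewrite Rabs_R0, (Rabs_pos_eq x) in e by lra; lra.
Qed.

(** * Extension of the data and existence *)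

(** Through [Rabs], only the values of [g] on the half-line enter, so one-sided continuity at [0]
    gives a continuous function on the line. *)
Definition even_weighted (mu : R) (g : R -> R) (y : R) : R := exp (mu * Rabs y) * g (Rabs y).

(* The solution of [D' = a * D + 2 * a * V], [D 0 = 0]. *)
Definition defect (a : R) (V : R -> R) (x : R) : R :=
  2 * a * exp (a * x) * RInt (fun s => exp (- a * s) * V s) 0 x.

(* With [V] the even reflection of [exp (mu * y) * g y], the extension [W] of [g]
   is chosen so that [exp (mu * y) * W y] is [V y] on the right and
   [V y + D (- y)] on the left. The equation of [D] says that, formally,
   [d/dy + a] applied to it is odd, a property preserved by the heat flow. *)
Definition extension (mu a : R) (g : R -> R) (y : R) : R :=
  exp (- mu * y) * (even_weighted mu g y + defect a (even_weighted mu g) (Rmax 0 (- y))).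

Lemma is_derive_primitive (h : R -> R) (a x : R) : cont h -> is_derive (fun y => RInt h a y) x (h x).
Proof.
  intros hc; apply (is_derive_RInt h _ a); [|apply hc].
  apply filter_forall; intros y; apply (RInt_correct (V := R_CompleteNormedModule)).
  now apply cont_ex_RInt.
Qed.

Lemma is_derive_defect (a : R) (V : R -> R) (x : R) : cont V ->
  is_derive (defect a V) x (a * defect a V x + 2 * a * V x).
Proof.
  intros hV; unfold defect.
  assert (h1 : is_derive (fun y => 2 * a * exp (a * y)) x (2 * a * (a * exp (a * x))))
    by (auto_derive; [trivial | ring]).
  assert (h2 : is_derive (fun y => RInt (fun s => exp (- a * s) * V s) 0 y) x
    (exp (- a * x) * V x)).
  { apply (is_derive_primitive (fun s => exp (- a * s) * V s)); cont_tac. }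
  apply (is_derive_mult_eq _ _ _ _ _ _ h1 h2).
  replace (- a * x) with (- (a * x)) by ring; rewrite exp_Ropp.
  pose proof (exp_pos (a * x)); field; lra.
Qed.

Lemma cont_defect (a : R) (V : R -> R) : cont V -> cont (defect a V).
Proof.
  intros hV x; apply (ex_derive_continuous (defect a V)).
  eexists; now apply is_derive_defect.
Qed.

Lemma defect_0 (a : R) (V : R -> R) : defect a V 0 = 0.
Proof. unfold defect; rewrite RInt_point; unfold zero; simpl; ring. Qed.

Lemma cont_even_weighted (mu : R) (g : R -> R) :
  cont (fun y => g (Rabs y)) -> cont (even_weighted mu g).
Proof.
  intros hg; apply (cont_mult (fun y => exp (mu * Rabs y)) (fun y => g (Rabs y))); cont_tac.
Qed.

Lemma cont_extension (mu a : R) (g : R -> R) :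
  cont (fun y => g (Rabs y)) -> cont (extension mu a g).
Proof.
  intros hg; pose proof (cont_even_weighted mu g hg) as hV.
  apply (cont_mult (fun y => exp (- mu * y))); [cont_tac|].
  apply cont_plus; [exact hV|].
  apply (cont_comp (defect a (even_weighted mu g)) (fun y => Rmax 0 (- y))).
  - now apply cont_defect.
  - apply cont_posneg.
Qed.

Lemma extension_pos (mu a : R) (g : R -> R) (y : R) : 0 <= y -> extension mu a g y = g y.
Proof.
  intros hy; unfold extension, even_weighted at 1.
  rewrite (Rmax_left 0) by lra; rewrite defect_0, (Rabs_pos_eq y) by exact hy.
  rewrite Rplus_0_r, <- Rmult_assoc, <- exp_plus.
  replace (- mu * y + mu * y) with 0 by ring; rewrite exp_0; ring.
Qed.

(** In the rate, one [Rabs a] comes from the prefactor, [Rabs a + k] from the integrand, and [1]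
    from bounding the length [x] of the interval by [exp x]. *)
Lemma defect_bound (a B k : R) (V : R -> R) (x : R) : cont V -> 0 <= B -> 0 <= k ->
  (forall y, Rabs (V y) <= B * exp (k * Rabs y)) -> 0 <= x ->
  Rabs (defect a V x) <= 2 * Rabs a * B * exp ((2 * Rabs a + k + 1) * x).
Proof.
  intros hV hB hk h hx; unfold defect.
  pose proof (Rabs_pos a) as ha; pose proof (Rle_abs a) as ha1.
  pose proof (Rle_abs (- a)) as ha2; rewrite Rabs_Ropp in ha2.
  rewrite !Rabs_mult, (Rabs_pos_eq 2), (Rabs_pos_eq (exp _)) by (try lra; apply Rlt_le, exp_pos).
  assert (hI : Rabs (RInt (fun s => exp (- a * s) * V s) 0 x)
    <= (x - 0) * (B * exp ((Rabs a + k) * x))).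
  { apply abs_RInt_le_const; [exact hx | apply cont_ex_RInt; cont_tac|].
    intros s hs; rewrite Rabs_mult, (Rabs_pos_eq (exp _)) by apply Rlt_le, exp_pos.
    specialize (h s); rewrite (Rabs_pos_eq s) in h by lra.
    apply Rle_trans with (exp (Rabs a * x) * (B * exp (k * x))).
    - apply Rmult_le_compat; [apply Rlt_le, exp_pos | apply Rabs_pos | |].
      + apply exp_le_compat; nra.
      + eapply Rle_trans; [exact h|]; apply Rmult_le_compat_l; [exact hB|].
        apply exp_le_compat; nra.
    - rewrite Rmult_plus_distr_r, exp_plus; apply Req_le; ring. }
  rewrite Rminus_0_r in hI.
  apply Rle_trans with (2 * Rabs a * exp (Rabs a * x) * (exp x * (B * exp ((Rabs a + k) * x)))).
  - apply Rmult_le_compat; [nonneg | apply Rabs_pos | |].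
    + apply Rmult_le_compat_l; [lra|]; apply exp_le_compat; nra.
    + eapply Rle_trans; [exact hI|]; apply Rmult_le_compat_r; [nonneg|].
      pose proof (exp_ineq1_le x); lra.
  - replace ((2 * Rabs a + k + 1) * x) with (Rabs a * x + (x + (Rabs a + k) * x)) by ring.
    rewrite !exp_plus; apply Req_le; ring.
Qed.

Lemma even_weighted_bound (mu M : R) (g : R -> R) (y : R) : 0 <= M ->
  (forall x, 0 <= x -> Rabs (g x) <= M) ->
  Rabs (even_weighted mu g y) <= M * exp (Rabs mu * Rabs y).
Proof.
  intros hM hg; unfold even_weighted; rewrite Rabs_mult, Rmult_comm.
  apply Rmult_le_compat; try apply Rabs_pos; [apply hg, Rabs_pos|].
  rewrite Rabs_pos_eq by apply Rlt_le, exp_pos; apply exp_le_compat.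
  apply Rmult_le_compat_r; [apply Rabs_pos | apply Rle_abs].
Qed.

Lemma extension_growth (mu a M : R) (g : R -> R) : 0 <= M ->
  cont (fun y => g (Rabs y)) -> (forall x, 0 <= x -> Rabs (g x) <= M) ->
  exists A K, growth_by A K (extension mu a g).
Proof.
  intros hM hc hg.
  pose proof (Rabs_pos a) as ha; pose proof (Rabs_pos mu) as hmu.
  (* The defect grows at rate [2 * Rabs a + Rabs mu + 1]; removing the weight [exp (mu * y)] costs
     another [Rabs mu]. *)
  exists (M * (1 + 2 * Rabs a)), (2 * Rabs a + 2 * Rabs mu + 1); split; [now apply cont_extension|].
  split; [lra|]; intros y.
  destruct (Rle_lt_dec 0 y) as [hy|hy].
  - rewrite extension_pos, Rmax_left, Rmult_0_r, exp_0 by lra.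
    eapply Rle_trans; [now apply hg|]; nra.
  - rewrite Rmax_right by lra; unfold extension; rewrite Rmax_right by lra.
    rewrite Rabs_mult, Rabs_pos_eq by apply Rlt_le, exp_pos.
    pose proof (even_weighted_bound mu M g) as hV.
    pose proof (defect_bound a M (Rabs mu) (even_weighted mu g) (- y)
      (cont_even_weighted mu g hc) hM hmu (fun z => hV z hM hg) ltac:(lra)) as hD.
    specialize (hV y hM hg); rewrite (Rabs_left y) in hV by exact hy.
    set (x := - y) in *.
    assert (hx : 0 < x) by (unfold x; lra).
    replace (- mu * y) with (mu * x) by (unfold x; ring).
    apply Rle_trans with (exp (Rabs mu * x) *
      (M * (1 + 2 * Rabs a) * exp ((2 * Rabs a + Rabs mu + 1) * x))).
    + apply Rmult_le_compat; [apply Rlt_le, exp_pos | apply Rabs_pos | |].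
      * apply exp_le_compat, Rmult_le_compat_r; [lra | apply Rle_abs].
      * eapply Rle_trans; [apply Rabs_triang|].
        apply Rle_trans with (M * exp ((2 * Rabs a + Rabs mu + 1) * x)
          + 2 * Rabs a * M * exp ((2 * Rabs a + Rabs mu + 1) * x)); [|apply Req_le; ring].
        apply Rplus_le_compat; [|exact hD].
        eapply Rle_trans; [exact hV|]; apply Rmult_le_compat_l; [exact hM|].
        apply exp_le_compat; nra.
    + replace ((2 * Rabs a + 2 * Rabs mu + 1) * x)
        with (Rabs mu * x + (2 * Rabs a + Rabs mu + 1) * x) by ring.
      rewrite exp_plus; apply Req_le; ring.
Qed.

(** Integrating a bounded function would only give linear growth to the right; the bound there is a
    hypothesis, supplied by the boundedness of [f], with which the primitive coincides. *)
Lemma primitive_growth (A K M c : R) (W : R -> R) :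
  growth_by A K W -> (forall x, 0 <= x -> Rabs (c + RInt W 0 x) <= M) ->
  growth_by (M + A) (K + 1) (fun x => c + RInt W 0 x).
Proof.
  intros hW hM; pose proof (growth_by_nonneg A K W hW) as hA.
  assert (hK : 0 <= K) by apply hW.
  assert (hM0 : Rabs c <= M).
  { specialize (hM 0 (Rle_refl 0)); rewrite RInt_point in hM.
    unfold zero in hM; simpl in hM; rewrite Rplus_0_r in hM; exact hM. }
  pose proof (Rabs_pos c) as hc0.
  split; [|split; [lra|]].
  - apply cont_plus; [apply cont_const|]. intros x.
    apply (ex_derive_continuous (fun x => RInt W 0 x)); eexists; apply is_derive_primitive, hW.
  - intros y; destruct (Rle_lt_dec 0 y) as [hy|hy].
    + rewrite Rmax_left, Rmult_0_r, exp_0 by lra; specialize (hM y hy); lra.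
    + rewrite Rmax_right by lra; set (x := - y).
      assert (hx : 0 < x) by (unfold x; lra).
      rewrite <- (opp_RInt_swap W y 0) by apply cont_ex_RInt, hW.
      unfold opp; simpl.
      assert (hI : Rabs (RInt W y 0) <= (0 - y) * (A * exp (K * x))).
      { apply abs_RInt_le_const; [lra | apply cont_ex_RInt, hW|].
        intros s hs; eapply Rle_trans; [apply (growth_by_abs A K W s hW)|].
        apply Rmult_le_compat_l; [exact hA|]; apply exp_le_compat, Rmult_le_compat_l; [exact hK|].
        unfold x; rewrite Rabs_left1; lra. }
      replace (0 - y) with x in hI by (unfold x; ring).
      eapply Rle_trans; [apply Rabs_triang|]; rewrite Rabs_Ropp.
      assert (h1 : 1 <= exp ((K + 1) * x)).
      { apply Rle_trans with (exp 0); [rewrite exp_0; lra | apply exp_le_compat; nra]. }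
      assert (h2 : x * (A * exp (K * x)) <= A * exp ((K + 1) * x)).
      { replace ((K + 1) * x) with (K * x + x) by ring; rewrite exp_plus.
        pose proof (exp_ineq1_le x).
        replace (x * (A * exp (K * x))) with (A * (exp (K * x) * x)) by ring.
        repeat (apply Rmult_le_compat_l; [nonneg|]); lra. }
      nra.
Qed.

(** With tilt exactly [mu], the integrand is [(2 * s * y + a) * exp (- s * y ^ 2)] times the gauged
    extension, and its weight [exp (- s * y ^ 2)] is even. Adding the values at [y] and [- y] and
    using the equation of the defect [D] leaves the exact derivative of
    [P y = exp (- s * y ^ 2) * D y]. The integral over a symmetric interval is therefore a boundary
    value of [P], which vanishes at [0] and in the limit. *)
Lemma moment_robin (mu a M s : R) (g : R -> R) : 0 <= M ->
  cont (fun y => g (Rabs y)) -> (forall x, 0 <= x -> Rabs (g x) <= M) -> 0 < s ->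
  2 * s * moment 1 (extension mu a g) s mu + a * moment 0 (extension mu a g) s mu = 0.
Proof.
  intros hM hc hg hs.
  set (W := extension mu a g); set (V := even_weighted mu g); set (D := defect a V).
  destruct (extension_growth mu a M g hM hc hg) as (A & K & hW); fold W in hW.
  assert (hV : cont V) by now apply cont_even_weighted.
  destruct (moment_density_rapid A K W 0 s mu hW hs) as [C0 h0].
  destruct (moment_density_rapid A K W 1 s mu hW hs) as [C1 h1].
  unfold moment; rewrite <- (integral_lin _ _ (2 * s) a _ _ h1 h0).
  pose proof (rapid_by_lin _ _ (2 * s) a _ _ h1 h0) as hr.
  set (k := fun y => 2 * s * moment_density 1 s mu W y + a * moment_density 0 s mu W y) in *.
  assert (hk : forall y, k y = (2 * s * y + a) * exp (- s * y ^ 2) * (V y + D (Rmax 0 (- y)))).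
  { intros y; unfold k, moment_density, W, extension; fold V; fold D; simpl (y ^ 1); simpl (y ^ 0).
    replace (mu * y - s * y ^ 2) with (- (- mu * y) + - s * y ^ 2) by ring.
    rewrite exp_plus, exp_Ropp; pose proof (exp_pos (- mu * y)); field; lra. }
  assert (hfold : forall y, 0 <= y -> k y + k (- y)
    = exp (- s * y ^ 2) * (a * D y + 2 * a * V y) + (- (2 * s * y)) * exp (- s * y ^ 2) * D y).
  { intros y hy; rewrite !hk, Ropp_involutive, (Rmax_left 0 (- y)), (Rmax_right 0 y) by lra.
    unfold D at 1; rewrite defect_0.
    replace (V (- y)) with (V y) by (unfold V, even_weighted; now rewrite Rabs_Ropp).
    replace ((- y) ^ 2) with (y ^ 2) by ring. ring. }
  set (P := fun y => exp (- s * y ^ 2) * D y).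
  assert (hP : forall y, is_derive P y
    (exp (- s * y ^ 2) * (a * D y + 2 * a * V y) + (- (2 * s * y)) * exp (- s * y ^ 2) * D y)).
  { intros y; unfold P.
    assert (e : is_derive (fun z => exp (- s * z ^ 2)) y (- (2 * s * y) * exp (- s * y ^ 2))).
    { auto_derive; [trivial|].
      replace (- s * (y * (y * 1))) with (- s * y ^ 2) by ring; ring. }
    apply (is_derive_mult_eq _ _ _ _ _ _ e (is_derive_defect a V y hV)); fold D; ring. }
  assert (hsym : forall n, RInt k (- INR n) (INR n) = P (INR n)).
  { intros n; pose proof (pos_INR n) as hn; set (N := INR n) in *.
    assert (hx : forall p q, ex_RInt k p q) by (intros; apply cont_ex_RInt, hr).
    assert (hko : cont (fun y => k (- y))).
    { apply (cont_comp k (fun y => - y)); [apply hr | cont_tac]. }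
    rewrite <- (RInt_Chasles k (- N) 0 N) by apply hx.
    assert (e1 : RInt k (- N) 0 = RInt (fun y => k (- y)) 0 N).
    { pose proof (RInt_comp_lin k (-1) 0 N 0 (hx _ _)) as e.
      replace (-1 * N + 0) with (- N) in e by ring.
      replace (-1 * 0 + 0) with 0 in e by ring.
      rewrite <- e, <- (opp_RInt_swap _ 0 N) by (apply cont_ex_RInt;
        apply (cont_mult (fun _ => -1)); [apply cont_const|];
        apply (cont_comp k (fun y => -1 * y + 0)); [apply hr | cont_tac]).
      rewrite <- (RInt_opp (V := R_CompleteNormedModule)) by (apply cont_ex_RInt;
        apply (cont_mult (fun _ => -1)); [apply cont_const|];
        apply (cont_comp k (fun y => -1 * y + 0)); [apply hr | cont_tac]).
      apply RInt_ext; intros y _; unfold opp, scal; simpl; unfold mult; simpl.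
      replace (-1 * y + 0) with (- y) by ring; ring. }
    rewrite e1; change (plus (G := R_AbelianMonoid)) with Rplus.
    transitivity (RInt (fun y => k (- y) + k y) 0 N).
    { symmetry; apply (RInt_plus (V := R_CompleteNormedModule) (fun y => k (- y)) k);
        [now apply cont_ex_RInt | apply hx]. }
    replace (P N) with (P N - P 0) by (unfold P, D; rewrite (defect_0 a V); ring).
    apply is_RInt_unique.
    apply (is_RInt_ext (fun y => exp (- s * y ^ 2) * (a * D y + 2 * a * V y)
      + (- (2 * s * y)) * exp (- s * y ^ 2) * D y)).
    - intros y hy; rewrite Rmin_left in hy by lra; rewrite <- hfold by lra; apply Rplus_comm.
    - apply (is_RInt_derive P); intros y _; [apply hP|].
      assert (hD : cont D) by now apply cont_defect.
      revert y; change (cont (fun y => exp (- s * y ^ 2) * (a * D y + 2 * a * V y)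
        + (- (2 * s * y)) * exp (- s * y ^ 2) * D y)).
      cont_tac. }
  apply integral_unique.
  apply (is_lim_seq_ext (fun n => P (INR n))); [intros; symmetry; apply hsym|].
  apply is_lim_seq_abs_0.
  (* The growth rate of the defect, beaten by the Gaussian factor of [P]. *)
  set (L := 2 * Rabs a + Rabs mu + 1).
  destruct (gauss_bound 0 L s hs) as [C [hC hG]].
  apply (is_lim_seq_le_le (fun _ => 0) _ (fun n => 2 * Rabs a * M * C * exp (- INR n))).
  - intros n; split; [apply Rabs_pos|]; pose proof (pos_INR n) as hn; set (N := INR n) in *.
    unfold P; rewrite Rabs_mult, Rabs_pos_eq by apply Rlt_le, exp_pos.
    specialize (hG N); rewrite (Rabs_pos_eq N) in hG by exact hn.
    replace (L * N - s * N ^ 2) with (- s * N ^ 2 + L * N) in hG by ring.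
    rewrite exp_plus in hG; simpl (N ^ 0) in hG; rewrite Rmult_1_l in hG.
    apply Rle_trans with (exp (- s * N ^ 2) * (2 * Rabs a * M * exp (L * N))).
    + apply Rmult_le_compat_l; [apply Rlt_le, exp_pos|].
      apply (defect_bound a M (Rabs mu) V N); auto; [apply Rabs_pos|].
      intros; now apply even_weighted_bound.
    + replace (exp (- s * N ^ 2) * (2 * Rabs a * M * exp (L * N)))
        with (2 * Rabs a * M * (exp (- s * N ^ 2) * exp (L * N))) by ring.
      rewrite (Rmult_assoc (2 * Rabs a * M) C); apply Rmult_le_compat_l; [|exact hG].
      pose proof (Rabs_pos a); nonneg.
  - apply is_lim_seq_const.
  - apply exp_neg_INR_lim.
Qed.

(** * Existence of a solution *)

Lemma cont_even_of_halfline (g : R -> R) :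
  (forall x, 0 <= x -> forall eps, 0 < eps -> exists delta, 0 < delta /\
     forall y, 0 <= y -> Rabs (y - x) < delta -> Rabs (g y - g x) < eps) ->
  cont (fun y => g (Rabs y)).
Proof.
  intros h x; apply continuity_pt_filterlim; intros eps he.
  destruct (h (Rabs x) (Rabs_pos x) eps he) as [d [hd H]].
  exists d; split; [exact hd|]; intros y [_ hy]; simpl in *; unfold Rdist in *.
  apply H; [apply Rabs_pos|]; eapply Rle_lt_trans; [apply Rabs_triang_inv2 | exact hy].
Qed.

Lemma solution_exists (mu nu : R) (f : R -> R) :
  C1b_halfline f -> tends_to_0_at_infty f -> exists u, is_solution mu nu f u.
Proof.
  intros (f' & hd & hc & [M0 hM0] & [M hM]) hlim.
  (* With this value, [d/dy + a] applied to [exp (mu * y) * W] is [2 * exp (mu * y) * (W' / 2 + (mu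
     - nu) * W)], the gauged Robin expression. *)
  set (a := mu - 2 * nu).
  assert (hM' : 0 <= M) by (specialize (hM 0 (Rle_refl 0)); pose proof (Rabs_pos (f' 0)); lra).
  pose proof (cont_even_of_halfline f' hc) as hcont.
  set (W := extension mu a f'); set (F := fun y => f 0 + RInt W 0 y).
  destruct (extension_growth mu a M f' hM' hcont hM) as (B & L & hW); fold W in hW.
  assert (hFd : forall y, is_derive F y (W y)).
  { intros y; rewrite <- (Rplus_0_l (W y)).
    apply (is_derive_plus (fun _ => f 0) (fun y => RInt W 0 y)).
    - exact (is_derive_const (K := R_AbsRing) (V := R_NormedModule) (f 0) y).
    - apply is_derive_primitive, hW. }
  assert (hFf : forall x, 0 <= x -> F x = f x).
  { intros x hx.
    assert (e : F x - f x = F 0 - f 0).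
    { apply (has_deriv_within_zero_const (fun y => F y - f y)); [|exact hx].
      intros y hy; replace 0 with (W y - f' y) by (unfold W; rewrite extension_pos; [ring|exact hy]).
      apply has_deriv_within_minus; [apply is_derive_within, hFd | now apply hd]. }
    unfold F in e at 2; rewrite RInt_point in e; unfold zero in e; simpl in e; lra. }
  assert (hF : growth_by (M0 + B) (L + 1) F).
  { apply primitive_growth; [exact hW|].
    intros x hx; fold (F x); rewrite hFf by exact hx; now apply hM0. }
  assert (hlimF : tends_to_0_at_infty F).
  { intros eps he; destruct (hlim eps he) as [A hA]; exists (Rmax 0 A); intros x hx.
    pose proof (Rmax_l 0 A); pose proof (Rmax_r 0 A).
    rewrite hFf by lra; apply hA; lra. }
  set (E := eval mu F heat_expr); set (Ex := eval mu W heat_expr).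
  set (Et := eval mu F (dt mu heat_expr)); set (Exx := eval mu W (dx mu heat_expr)).
  assert (hEx : forall t x, 0 < t -> is_derive (E t) x (Ex t x)).
  { intros t x ht; unfold Ex; rewrite <- (eval_dx_heat (M0 + B) (L + 1) B L mu F W) by assumption.
    now apply (is_derive_eval_x (M0 + B) (L + 1)). }
  exists (heat mu F); split; [|split; [|split; [|split]]].
  - intros k; apply (Ck_Dom_ext k E).
    + intros t x [ht hx]; symmetry; now apply (heat_eval (M0 + B) (L + 1)).
    + now apply (Ck_Dom_eval (M0 + B) (L + 1)).
  - exists (heat mu W); split.
    + intros t x [ht|<-] hx.
      * rewrite (heat_eval B L) by assumption.
        apply (has_deriv_within_ext _ (E t)); [exact hx| |apply is_derive_within, hEx, ht].
        intros y hy; symmetry; now apply (heat_eval (M0 + B) (L + 1)).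
      * rewrite (heat_0 B L) by assumption.
        apply (has_deriv_within_ext _ F); [exact hx| |apply is_derive_within, hFd].
        intros y hy; symmetry; now apply (heat_0 (M0 + B) (L + 1)).
    + intros T hT; split; [|split; [|split]].
      * now apply (heat_cont_strip (M0 + B) (L + 1)).
      * apply (heat_bounded (M0 + B) (L + 1)); [exact hF | lra].
      * now apply (heat_cont_strip B L).
      * apply (heat_bounded B L); [exact hW | lra].
  - intros t ht; apply (heat_tends_to_0 (M0 + B) (L + 1)); [exact hF | lra | exact hlimF].
  - exists Et, Ex, Exx; split; [|split].
    + intros t x hD; pose proof hD as [ht hx]; rewrite <- and_assoc; split.
      * apply (pd_ext_Dom E); [|exact hD|].
        -- intros s y [hs hy]; symmetry; now apply (heat_eval (M0 + B) (L + 1)).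
        -- split; apply is_derive_within; [now apply (is_derive_eval_t (M0 + B) (L + 1))|].
           now apply hEx.
      * apply is_derive_within; now apply (is_derive_eval_x B L).
    + intros t x [ht hx]; unfold Et; rewrite eval_heat_equation.
      rewrite (eval_dx_heat (M0 + B) (L + 1) B L mu F W) by assumption.
      now rewrite (eval_dxx_heat (M0 + B) (L + 1) B L mu F W) by assumption.
    + intros t ht; unfold Et; rewrite eval_heat_equation.
      rewrite (eval_dx_heat (M0 + B) (L + 1) B L mu F W) by assumption.
      rewrite (eval_dxx_heat (M0 + B) (L + 1) B L mu F W) by assumption.
      pose proof (moment_robin mu a M (/ (2 * t)) f' hM' hcont hM (inv_2t_pos t ht)) as e.
      fold W in e; unfold Ex, a in *; simpl; unfold heat_moment.
      (* At [x = 0] the tilt is [mu], for every [t]. In terms of the moments of [W] the boundary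
         condition then reads [/ t * m1 = - a * m0], which is [moment_robin]. *)
      replace ((0 + mu * t) / t) with mu by (field; lra).
      replace (2 * / (2 * t)) with (/ t) in e by (field; lra).
      generalize dependent (moment 1 W (/ (2 * t)) mu).
      generalize (moment 0 W (/ (2 * t)) mu); intros m0 m1 e.
      generalize (/ sqrt t * exp (- (0 + mu * t) ^ 2 / (2 * t))); intros q.
      generalize (/ gauss_mass); intros c.
      assert (e' : / t * m1 = - ((mu - 2 * nu) * m0)) by lra.
      replace (/ t * (q * m1)) with (q * (/ t * m1)) by ring; rewrite e'; field; lra.
  - intros x hx; rewrite (heat_0 (M0 + B) (L + 1)) by assumption; now apply hFf.
Qed.

(** * Maximum principle for the Robin problem *)

Definition rect (T L t x : R) : Prop := 0 <= t <= T /\ 0 <= x <= L.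

(** Without a maximum, each point has a neighbourhood on which [z] stays below some value it takes
    in the rectangle. Finitely many neighbourhoods cover, and the largest of the corresponding
    values would lie below itself. *)
Lemma rect_max (T L : R) (z : R -> R -> R) : 0 <= T -> 0 <= L -> cont2_on (rect T L) z ->
  exists t0 x0, rect T L t0 x0 /\ forall t x, rect T L t x -> z t x <= z t0 x0.
Proof.
  intros hT hL hc; apply NNPP; intros hno.
  assert (hbig : forall t x, rect T L t x -> exists t' x', rect T L t' x' /\ z t x < z t' x').
  { intros t x hr; apply NNPP; intros h; apply hno; exists t, x; split; [exact hr|].
    intros t' x' hr'; apply Rnot_lt_le; intros hlt; apply h; now exists t', x'. }
  assert (hloc : forall p : Compactness.Tn 2 R, exists d : posreal,
    rect T L (fst p) (fst (snd p)) -> exists t' x', rect T L t' x' /\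
      forall t x, rect T L t x -> Rabs (t - fst p) < d -> Rabs (x - fst (snd p)) < d ->
        z t x < z t' x').
  { intros [t0 [x0 []]]; simpl.
    destruct (classic (rect T L t0 x0)) as [hr|hr].
    - destruct (hbig t0 x0 hr) as (t' & x' & hr' & hlt).
      destruct (hc t0 x0 hr (z t' x' - z t0 x0) ltac:(lra)) as [d [hd H]].
      exists (mkposreal d hd); intros _; exists t', x'; split; [exact hr'|].
      intros t x hrt h1 h2; specialize (H t x hrt h1 h2).
      apply Rabs_def2 in H; lra.
    - exists (mkposreal 1 Rlt_0_1); intros h; contradiction. }
  set (delta := fun p => proj1_sig (constructive_indefinite_description _ (hloc p))).
  assert (hdelta : forall p, rect T L (fst p) (fst (snd p)) -> exists t' x', rect T L t' x' /\
      forall t x, rect T L t x -> Rabs (t - fst p) < delta p -> Rabs (x - fst (snd p)) < delta p ->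
        z t x < z t' x').
  { intros p; apply (proj2_sig (constructive_indefinite_description _ (hloc p))). }
  (* The finite cover is available under a double negation, which the goal [False] absorbs. *)
  apply (compactness_list 2 (0, (0, tt)) (T, (L, tt)) delta); intros [l hl].
  assert (hsup : exists t1 x1, rect T L t1 x1 /\ forall p, In p l ->
    rect T L (fst p) (fst (snd p)) ->
    forall t x, rect T L t x -> Rabs (t - fst p) < delta p -> Rabs (x - fst (snd p)) < delta p ->
      z t x < z t1 x1).
  { clear hl; induction l as [|p l IH].
    - exists 0, 0; split; [unfold rect; lra | intros p []].
    - destruct IH as (t1 & x1 & hr1 & H1).
      destruct (classic (rect T L (fst p) (fst (snd p)))) as [hp|hp].
      + destruct (hdelta p hp) as (t2 & x2 & hr2 & H2).
        destruct (Rle_lt_dec (z t1 x1) (z t2 x2)) as [hle|hlt].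
        * exists t2, x2; split; [exact hr2|]; intros q [<-|hq] hrq t x hr h1 h2.
          -- now apply H2.
          -- eapply Rlt_le_trans; [now apply (H1 q) | exact hle].
        * exists t1, x1; split; [exact hr1|]; intros q [<-|hq] hrq t x hr h1 h2.
          -- eapply Rlt_trans; [now apply H2 | exact hlt].
          -- now apply (H1 q).
      + exists t1, x1; split; [exact hr1|]; intros q [<-|hq] hrq; [contradiction|].
        now apply H1. }
  destruct hsup as (t1 & x1 & hr1 & H).
  destruct (hl (t1, (x1, tt))) as ([t [x []]] & hin & hb & hcl).
  { simpl; unfold rect in hr1; tauto. }
  simpl in hb, hcl.
  apply (Rlt_irrefl (z t1 x1)), (H (t, (x, tt)) hin); simpl; unfold rect; tauto.
Qed.

Lemma has_deriv_within_right_le0 (S : R -> Prop) (g : R -> R) (x l eta : R) :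
  0 < eta -> (forall h, 0 < h < eta -> S (x + h) /\ g (x + h) <= g x) ->
  has_deriv_within S g x l -> l <= 0.
Proof.
  intros heta hm hd; apply Rnot_lt_le; intros hl.
  destruct (hd l hl) as [d [hd0 H]].
  set (h := Rmin d eta / 2).
  pose proof (Rmin_l d eta); pose proof (Rmin_r d eta).
  assert (0 < Rmin d eta) by now apply Rmin_glb_lt.
  assert (hh : 0 < h < eta) by (unfold h; lra).
  destruct (hm h hh) as [hS hle].
  specialize (H h ltac:(lra) ltac:(rewrite Rabs_pos_eq; unfold h; lra) hS).
  apply Rabs_def2 in H.
  assert ((g (x + h) - g x) / h <= 0); [|lra].
  apply Rmult_le_reg_r with h; [lra|].
  replace ((g (x + h) - g x) / h * h) with (g (x + h) - g x) by (field; lra). lra.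
Qed.

(** Only earlier points are compared, so that it applies in time at a maximum on the final edge
    [t = T]. *)
Lemma is_derive_left_ge0 (g : R -> R) (x l eta : R) :
  0 < eta -> (forall h, 0 < h < eta -> g (x - h) <= g x) -> is_derive g x l -> 0 <= l.
Proof.
  intros heta hm hd.
  assert (h : - l <= 0); [|lra].
  apply (has_deriv_within_right_le0 (fun _ => True) (fun y => g (- y)) (- x) (- l) eta heta).
  - intros h hh; split; [exact I|].
    replace (- (- x + h)) with (x - h) by ring; rewrite Ropp_involutive; now apply hm.
  - apply is_derive_within.
    replace (- l) with (-1 * l) by ring.
    apply (is_derive_comp g (fun y => - y)).
    + now rewrite Ropp_involutive.
    + auto_derive; [trivial | ring].
Qed.

(** If [l] were positive, [dg] would be positive just to the right of its zero [x], and [g] would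
    increase there by the mean value theorem. *)
Lemma local_max_derivs (g dg : R -> R) (x l eta : R) :
  0 < eta -> (forall y, Rabs (y - x) < eta -> is_derive g y (dg y) /\ g y <= g x) ->
  is_derive dg x l -> dg x = 0 /\ l <= 0.
Proof.
  intros heta hg hl.
  assert (hgx := proj1 (hg x ltac:(rewrite Rminus_diag, Rabs_R0; exact heta))).
  assert (h0 : dg x = 0).
  { apply Rle_antisym.
    - apply (has_deriv_within_right_le0 (fun _ => True) g x (dg x) eta heta).
      + intros h hh; split; [exact I|]; apply hg.
        replace (x + h - x) with h by ring; rewrite Rabs_pos_eq; lra.
      + now apply is_derive_within.
    - apply (is_derive_left_ge0 g x (dg x) eta heta); [|exact hgx].
      intros h hh; apply hg.
      replace (x - h - x) with (- h) by ring; rewrite Rabs_Ropp, Rabs_pos_eq; lra. }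
  split; [exact h0|]; apply Rnot_lt_le; intros hlp.
  apply is_derive_Reals in hl; destruct (hl l hlp) as [d hd].
  pose proof (cond_pos d) as hd0.
  set (h := Rmin d eta / 2).
  pose proof (Rmin_l d eta); pose proof (Rmin_r d eta).
  assert (0 < Rmin d eta) by now apply Rmin_glb_lt.
  assert (hh : 0 < h) by (unfold h; lra).
  destruct (MVT_cor2 g dg x (x + h)) as [c [e hc]]; [lra| |].
  - intros c hc; apply is_derive_Reals, hg; rewrite Rabs_pos_eq; unfold h in hc; lra.
  - specialize (hd (c - x) ltac:(lra) ltac:(rewrite Rabs_pos_eq; unfold h in hc; lra)).
    replace (x + (c - x)) with c in hd by ring; rewrite h0, Rminus_0_r in hd.
    apply Rabs_def2 in hd.
    assert (hpos : 0 < dg c).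
    { apply Rmult_lt_reg_r with (/ (c - x)); [apply Rinv_0_lt_compat; lra|].
      rewrite Rmult_0_l; unfold Rdiv in hd; lra. }
    assert (g (x + h) <= g x).
    { apply hg; replace (x + h - x) with h by ring; rewrite Rabs_pos_eq; unfold h; lra. }
    nra.
Qed.

(* The barrier [exp (lam * t) * (exp (- b * x) + exp x)]
   has so negative a logarithmic derivative at [0] that the sign of [k] is irrelevant,
   and it grows in [x], so the quotient of [w] by it attains its supremum. *)
Lemma robin_le0 (mu k T : R) (w wt wx wxx : R -> R -> R) : 0 < T ->
  cont2_on (strip T) w -> bdd2_on (strip T) w -> (forall x, 0 <= x -> w 0 x = 0) ->
  (forall t x, 0 < t -> 0 < x ->
     is_derive (fun s => w s x) t (wt t x) /\ is_derive (w t) x (wx t x) /\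
     is_derive (wx t) x (wxx t x) /\ wt t x = mu * wx t x + / 2 * wxx t x) ->
  (forall t, 0 < t -> has_deriv_within halfline (w t) 0 (k * w t 0)) ->
  forall t x, strip T t x -> w t x <= 0.
Proof.
  intros hT hc [M hM] h0 hpde hbc t1 x1 hs1; apply Rnot_lt_le; intros hpos.
  (* At [0] the barrier has value [2] and slope [1 - b], up to the time factor; contact there would
     force [2 * k + b - 1 <= 0], whereas this choice makes the left side at least [1]. *)
  set (b := 2 * Rabs k + 2).
  assert (hb : 2 <= b) by (pose proof (Rabs_pos k); unfold b; lra).
  set (S := fun x => exp (- b * x) + exp x).
  set (S1 := fun x => - b * exp (- b * x) + exp x).
  set (S2 := fun x => b ^ 2 * exp (- b * x) + exp x).
  assert (hS : forall x, 0 < S x).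
  { intros x; unfold S; pose proof (exp_pos (- b * x)); pose proof (exp_pos x); lra. }
  assert (dS : forall x, is_derive S x (S1 x)).
  { intros x; unfold S, S1; auto_derive; [trivial | ring]. }
  assert (dS1 : forall x, is_derive S1 x (S2 x)).
  { intros x; unfold S2, S1; auto_derive; [trivial | ring]. }
  (* Since [S1] is at most [(b + 1) * S] in absolute value and [S2 / 2] is below [(b ^ 2 + 1) * S],
     this makes the barrier a strict supersolution. *)
  set (lam := Rabs mu * (b + 1) + (b ^ 2 + 1)).
  assert (hmu : 0 <= Rabs mu) by apply Rabs_pos.
  assert (hlam : forall x, mu * S1 x + / 2 * S2 x < lam * S x).
  { intros x; pose proof (hS x) as hSx.
    assert (hE : 0 < exp (- b * x)) by apply exp_pos.
    assert (hE2 : 0 < exp x) by apply exp_pos.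
    assert (a1 : mu * S1 x <= Rabs mu * (b + 1) * S x).
    { eapply Rle_trans; [apply Rle_abs|]; rewrite Rabs_mult, Rmult_assoc.
      apply Rmult_le_compat_l; [exact hmu|].
      unfold S1, S; apply Rabs_le; split; nra. }
    assert (a2 : / 2 * S2 x < (b ^ 2 + 1) * S x) by (unfold S2, S; nra).
    unfold lam; lra. }
  set (e := fun t => exp (lam * t)).
  assert (he : forall t, 0 < e t) by (intros; apply exp_pos).
  assert (he1 : forall t, 0 <= t -> 1 <= e t).
  { intros t ht; apply Rle_trans with (exp 0); [rewrite exp_0; lra|].
    apply exp_le_compat, Rmult_le_pos; [unfold lam; nra | exact ht]. }
  set (z := fun t x => w t x * / (e t * S x)).
  assert (heS : forall t x, 0 < e t * S x) by (intros; now apply Rmult_lt_0_compat).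
  assert (hz : forall t x, w t x = z t x * (e t * S x)).
  { intros t x; unfold z; field; specialize (heS t x); split; apply Rgt_not_eq;
      [apply hS | apply he]. }
  set (m1 := z t1 x1).
  assert (hm1 : 0 < m1) by (apply Rmult_lt_0_compat; [exact hpos | apply Rinv_0_lt_compat, heS]).
  assert (hM0 : 0 <= M).
  { specialize (hM t1 x1 hs1); pose proof (Rabs_pos (w t1 x1)); lra. }
  (* For [x >= L] one has [w <= M <= m1 * x], while the barrier exceeds [x + 1], so the quotient [z]
     stays below its value [m1] at the assumed positive point. *)
  set (L := Rmax x1 (M / m1)).
  assert (hL : 0 <= L) by (eapply Rle_trans; [apply hs1 | apply Rmax_l]).
  assert (hfar : forall t x, strip T t x -> L <= x -> z t x < m1).
  { intros t x hs hx; apply Rmult_lt_reg_r with (e t * S x); [apply heS|]; rewrite <- hz.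
    pose proof (hM t x hs) as hw; pose proof (Rle_abs (w t x)).
    assert (hMx : M <= m1 * x).
    { apply Rle_trans with (m1 * (M / m1)); [apply Req_le; field; lra|].
      apply Rmult_le_compat_l; [lra|]; eapply Rle_trans; [apply Rmax_r | exact hx]. }
    assert (x + 1 < e t * S x).
    { pose proof (exp_ineq1_le x); pose proof (exp_pos (- b * x)).
      specialize (he1 t ltac:(apply hs)); assert (x + 1 < S x) by (unfold S; lra).
      specialize (hS x); nra. }
    nra. }
  assert (hzc : cont2_on (rect T L) z).
  { intros t x hr eps heps.
    assert (hs : strip T t x) by (unfold strip, rect in *; lra).
    assert (hc2 : continuity_2d_pt (fun s y => / (e s * S y)) t x).
    { apply (continuity_2d_pt_inv (fun s y => e s * S y)); [|specialize (heS t x); lra].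
      apply continuity_2d_pt_mult.
      - apply (continuity_1d_2d_pt_comp e (fun s _ => s)); [|apply continuity_2d_pt_id1].
        apply continuity_pt_filterlim, (cont_exp (fun s => lam * s)); cont_tac.
      - apply (continuity_1d_2d_pt_comp S (fun _ y => y)); [|apply continuity_2d_pt_id2].
        apply continuity_pt_filterlim, (ex_derive_continuous S); eexists; apply dS. }
    set (q := fun s y => / (e s * S y)) in *.
    assert (hq : 0 < q t x) by apply Rinv_0_lt_compat, heS.
    set (r := eps / (2 * (M + q t x + 1))).
    assert (hr0 : 0 < r) by (apply Rdiv_lt_0_compat; lra).
    assert (hr1 : r * (M + q t x + 1) = eps / 2) by (unfold r; field; lra).
    destruct (hc t x hs r hr0) as [d1 [hd1 H1]].
    destruct (hc2 (mkposreal r hr0)) as [d2 H2]; simpl in H2.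
    exists (Rmin d1 d2); split; [apply Rmin_glb_lt; [exact hd1 | apply cond_pos]|].
    intros s y hr' h1 h2; pose proof (Rmin_l d1 d2); pose proof (Rmin_r d1 d2).
    assert (hs' : strip T s y) by (unfold strip, rect in *; lra).
    specialize (H1 s y hs' ltac:(lra) ltac:(lra)); specialize (H2 s y ltac:(lra) ltac:(lra)).
    unfold z; fold (q s y); fold (q t x).
    replace (w s y * q s y - w t x * q t x)
      with (w s y * (q s y - q t x) + (w s y - w t x) * q t x) by ring.
    eapply Rle_lt_trans; [apply Rabs_triang|]; rewrite !Rabs_mult, (Rabs_pos_eq (q t x)) by lra.
    specialize (hM s y hs'); pose proof (Rabs_pos (w s y)); pose proof (Rabs_pos (q s y - q t x)).
    pose proof (Rabs_pos (w s y - w t x)).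
    assert (Rabs (w s y) * Rabs (q s y - q t x) <= M * r) by (apply Rmult_le_compat; lra).
    assert (Rabs (w s y - w t x) * q t x <= r * q t x) by (apply Rmult_le_compat_r; lra).
    lra. }
  destruct (rect_max T L z ltac:(lra) hL hzc) as (t0 & x0 & hr0 & hmax).
  set (m := z t0 x0).
  assert (hm : m1 <= m).
  { apply hmax; unfold strip in hs1; unfold rect; pose proof (Rmax_l x1 (M / m1)).
    fold L in H; lra. }
  (* The maximum over the rectangle is thus one over the strip: [m] times the barrier lies above [w]
     and touches it at [(t0, x0)]. *)
  assert (hall : forall t x, strip T t x -> w t x <= m * (e t * S x)).
  { intros t x hs; rewrite hz; apply Rmult_le_compat_r; [apply Rlt_le, heS|].
    destruct (Rle_lt_dec L x) as [hx|hx].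
    - specialize (hfar t x hs hx); lra.
    - apply hmax; unfold strip in hs; unfold rect; lra. }
  pose proof (hz t0 x0) as heq; fold m in heq.
  assert (hs0 : strip T t0 x0) by (unfold strip, rect in *; lra).
  assert (ht0 : 0 < t0).
  { destruct hr0 as [[[h|<-] _] hx0]; [exact h|].
    unfold m, z in *; rewrite h0 in hm by lra; lra. }
  destruct hs0 as [[_ ht0T] [hx0|hx0]].
  (* Contact at an interior point: the first- and second-order conditions together with the equation
     for [w] contradict the strict supersolution inequality. *)
  - destruct (hpde t0 x0 ht0 hx0) as (d1 & d2 & d3 & eq).
    assert (k1 : 0 <= wt t0 x0 - m * (lam * e t0 * S x0)).
    { apply (is_derive_left_ge0 (fun s => w s x0 - m * (e s * S x0)) t0 _ t0 ht0).
      - intros h hh; rewrite heq, Rminus_diag.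
        specialize (hall (t0 - h) x0 ltac:(unfold strip; lra)); lra.
      - apply (is_derive_minus (fun s => w s x0) (fun s => m * (e s * S x0))); [exact d1|].
        unfold e; auto_derive; [trivial | ring]. }
    assert (k2 : wx t0 x0 - m * e t0 * S1 x0 = 0 /\ wxx t0 x0 - m * e t0 * S2 x0 <= 0).
    { apply (local_max_derivs (fun y => w t0 y - m * e t0 * S y)
        (fun y => wx t0 y - m * e t0 * S1 y) x0 _ x0 hx0).
      - intros y hy; apply Rabs_def2 in hy; split.
        + apply (is_derive_minus (w t0) (fun y => m * e t0 * S y)).
          * apply hpde; lra.
          * apply (is_derive_scal S y (m * e t0)), dS.
        + specialize (hall t0 y ltac:(unfold strip; lra)); lra.
      - apply (is_derive_minus (wx t0) (fun y => m * e t0 * S1 y)); [exact d3|].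
        apply (is_derive_scal S1 x0 (m * e t0)), dS1. }
    destruct k2 as [k2 k3].
    specialize (hlam x0).
    assert (hme : 0 < m * e t0) by (apply Rmult_lt_0_compat; [lra | apply he]).
    apply (Rmult_lt_compat_l _ _ _ hme) in hlam.
    replace (wx t0 x0) with (m * e t0 * S1 x0) in eq by lra.
    lra.
  (* Contact on the boundary: the touching difference has nonpositive right derivative at [0], which
     the choice of [b] excludes. *)
  - rewrite <- hx0 in *.
    assert (k1 : k * w t0 0 - m * e t0 * S1 0 <= 0).
    { apply (has_deriv_within_right_le0 halfline (fun y => w t0 y - m * e t0 * S y) 0 _ 1 Rlt_0_1).
      - intros h hh; split; [unfold halfline; lra|].
        specialize (hall t0 (0 + h) ltac:(unfold strip; lra)); lra.
      - apply has_deriv_within_minus; [now apply hbc|].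
        apply is_derive_within, (is_derive_scal S 0 (m * e t0)), dS. }
    rewrite heq in k1.
    assert (hme : 0 < m * e t0) by (apply Rmult_lt_0_compat; [lra | apply he]).
    assert (hS0 : S 0 = 2) by (unfold S; rewrite Rmult_0_r, exp_0; ring).
    assert (hS10 : S1 0 = 1 - b) by (unfold S1; rewrite Rmult_0_r, exp_0; ring).
    rewrite hS0, hS10 in k1; unfold b in k1.
    pose proof (Rle_abs (- k)) as hk; rewrite Rabs_Ropp in hk. nra.
Qed.

(** * Uniqueness *)

Lemma locally_2d_quadrant (P : R -> R -> Prop) (t x : R) : 0 < t -> 0 < x ->
  (forall s y, 0 < s -> 0 < y -> P s y) -> locally_2d P t x.
Proof.
  intros ht hx h; assert (hm : 0 < Rmin t x) by now apply Rmin_glb_lt.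
  exists (mkposreal _ hm); simpl; intros s y hs hy.
  pose proof (Rmin_l t x); pose proof (Rmin_r t x).
  apply Rabs_def2 in hs; apply Rabs_def2 in hy; apply h; lra.
Qed.

Lemma locally_pos (P : R -> Prop) (x : R) : 0 < x -> (forall y, 0 < y -> P y) -> locally x P.
Proof.
  intros hx h; exists (mkposreal x hx); intros y hy.
  apply (Rabs_def2 (y - x)) in hy; simpl in hy; apply h; lra.
Qed.

(** It is used to exchange [u_tx] and [u_xt], so that differentiating the equation of [u] in [x]
    yields an equation for the slope. *)
Lemma schwarz_quadrant (f ft fx ftx fxt : R -> R -> R) :
  (forall t x, 0 < t -> 0 < x ->
     is_derive (fun s => f s x) t (ft t x) /\ is_derive (f t) x (fx t x) /\
     is_derive (ft t) x (ftx t x) /\ is_derive (fun s => fx s x) t (fxt t x) /\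
     continuity_2d_pt ftx t x /\ continuity_2d_pt fxt t x) ->
  forall t x, 0 < t -> 0 < x -> ftx t x = fxt t x.
Proof.
  intros h.
  assert (dt1 : forall t x, 0 < t -> 0 < x -> Derive (fun s => f s x) t = ft t x)
    by (intros t x ht hx; apply is_derive_unique, h; auto).
  assert (dx1 : forall t x, 0 < t -> 0 < x -> Derive (fun y => f t y) x = fx t x)
    by (intros t x ht hx; apply is_derive_unique, h; auto).
  assert (hxt : forall t x, 0 < t -> 0 < x ->
    is_derive (fun s => Derive (fun y => f s y) x) t (fxt t x)).
  { intros t x ht hx; apply (is_derive_ext_loc (fun s => fx s x)); [|apply h; auto].
    apply locally_pos; [exact ht|]; intros s hs; symmetry; auto. }
  assert (htx : forall t x, 0 < t -> 0 < x ->
    is_derive (fun y => Derive (fun s => f s y) t) x (ftx t x)).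
  { intros t x ht hx; apply (is_derive_ext_loc (ft t)); [|apply h; auto].
    apply locally_pos; [exact hx|]; intros y hy; symmetry; auto. }
  intros t x ht hx.
  rewrite <- (is_derive_unique _ _ _ (htx t x ht hx)), <- (is_derive_unique _ _ _ (hxt t x ht hx)).
  symmetry; apply (Schwarz f t x).
  - apply locally_2d_quadrant; auto; intros s y hs hy.
    destruct (h s y hs hy) as (h1 & h2 & _); repeat split.
    + now exists (ft s y).
    + now exists (fx s y).
    + exists (fxt s y); now apply hxt.
    + exists (ftx s y); now apply htx.
  - apply (continuity_2d_pt_ext_loc fxt); [|apply h; auto].
    apply locally_2d_quadrant; auto; intros s y hs hy.
    symmetry; apply is_derive_unique; now apply hxt.
  - apply (continuity_2d_pt_ext_loc ftx); [|apply h; auto].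
    apply locally_2d_quadrant; auto; intros s y hs hy.
    symmetry; apply is_derive_unique; now apply htx.
Qed.

Lemma cont2_on_Dom_interior (u : R -> R -> R) (t x : R) :
  cont2_on Dom u -> 0 < t -> 0 < x -> continuity_2d_pt u t x.
Proof.
  intros hc ht hx eps.
  destruct (hc t x ltac:(split; lra) eps (cond_pos eps)) as [d [hd H]].
  assert (hm : 0 < Rmin d (Rmin t x)) by now repeat apply Rmin_glb_lt.
  exists (mkposreal _ hm); simpl; intros s y hs hy.
  pose proof (Rmin_l d (Rmin t x)); pose proof (Rmin_r d (Rmin t x)).
  pose proof (Rmin_l t x); pose proof (Rmin_r t x).
  apply H; [|lra|lra].
  apply Rabs_def2 in hs; apply Rabs_def2 in hy; split; lra.
Qed.

Lemma eq_of_Rabs_lt (a b : R) : (forall eps, 0 < eps -> Rabs (a - b) < eps) -> a = b.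
Proof.
  intros h; destruct (Req_dec a b) as [e|hne]; [exact e|].
  specialize (h (Rabs (a - b)) ltac:(apply Rabs_pos_lt; lra)); lra.
Qed.

Lemma has_deriv_within_unique (S : R -> Prop) (g : R -> R) (x a b : R) :
  (forall y, x <= y -> S y) ->
  has_deriv_within S g x a -> has_deriv_within S g x b -> a = b.
Proof.
  intros hS ha hb; apply eq_of_Rabs_lt; intros eps he.
  destruct (ha (eps / 2) ltac:(lra)) as [d1 [hd1 H1]].
  destruct (hb (eps / 2) ltac:(lra)) as [d2 [hd2 H2]].
  set (h := Rmin d1 d2 / 2).
  pose proof (Rmin_l d1 d2); pose proof (Rmin_r d1 d2).
  assert (0 < Rmin d1 d2) by now apply Rmin_glb_lt.
  assert (hh : Rabs h = h) by (apply Rabs_pos_eq; unfold h; lra).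
  specialize (H1 h ltac:(unfold h; lra) ltac:(rewrite hh; unfold h; lra)
    ltac:(apply hS; unfold h; lra)).
  specialize (H2 h ltac:(unfold h; lra) ltac:(rewrite hh; unfold h; lra)
    ltac:(apply hS; unfold h; lra)).
  replace (a - b) with (((g (x + h) - g x) / h - b) - ((g (x + h) - g x) / h - a)) by ring.
  eapply Rle_lt_trans; [apply Rabs_triang|]; rewrite Rabs_Ropp; lra.
Qed.

Lemma pd_x_unique (u v : R -> R -> R) (t x a b : R) : 0 <= x ->
  (forall y, 0 <= y -> u t y = v t y) -> pd_x u t x a -> pd_x v t x b -> a = b.
Proof.
  intros hx e ha hb; apply (has_deriv_within_unique halfline (v t) x).
  - unfold halfline; intros; lra.
  - now apply (has_deriv_within_ext _ (fun y => u t y)).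
  - exact hb.
Qed.

Lemma pd_t_unique (u : R -> R -> R) (t x a b : R) : 0 < t ->
  pd_t u t x a -> pd_t u t x b -> a = b.
Proof.
  intros ht; apply has_deriv_within_unique; unfold pos_halfline; intros; lra.
Qed.

(** The smoothness, regularity and equation clauses each supply their own partial derivatives;
    uniqueness of one-sided derivatives identifies them on [Dom]. The slope [w] is taken from the
    regularity clause, the only one reaching [t = 0]. *)
Lemma slope_robin_problem (mu nu : R) (f : R -> R) (u : R -> R -> R) : is_solution mu nu f u ->
  exists w wt wx wxx : R -> R -> R,
    (forall t x, 0 <= t -> 0 <= x -> pd_x u t x (w t x)) /\
    (forall T, 0 < T -> cont2_on (strip T) w /\ bdd2_on (strip T) w) /\
    (forall t x, 0 < t -> 0 < x ->
       is_derive (fun s => w s x) t (wt t x) /\ is_derive (w t) x (wx t x) /\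
       is_derive (wx t) x (wxx t x) /\ wt t x = mu * wx t x + / 2 * wxx t x) /\
    (forall t, 0 < t -> has_deriv_within halfline (w t) 0 (2 * (nu - mu) * w t 0)).
Proof.
  intros (hC & (w & hw & hcb) & _ & (ut & ux & uxx & hd & hpde & hbc) & _).
  (* Order three reaches [w_xx], which is [u_xxx], and includes the continuity of both mixed second
     derivatives. *)
  destruct (hC 3%nat) as (_ & ut' & w' & hd' & (_ & utt & utx & hdt & _ & (cutx & _))
    & (_ & wt & wx & hdw & (cwt & _) & (_ & wxt & wxx & hdwx & _ & _))).
  assert (ew : forall t x, Dom t x -> w' t x = w t x).
  { intros t x [ht hx]; apply (pd_x_unique u u t x); auto.
    - apply hd'; now split.
    - apply hw; lra. }
  assert (eux : forall t x, Dom t x -> ux t x = w t x).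
  { intros t x [ht hx]; apply (pd_x_unique u u t x); auto.
    - apply hd; now split.
    - apply hw; lra. }
  assert (eut : forall t x, Dom t x -> ut' t x = ut t x).
  { intros t x hD; apply (pd_t_unique u t x); [apply hD | now apply hd' | now apply hd]. }
  assert (euxx : forall t x, Dom t x -> uxx t x = wx t x).
  { intros t x hD; pose proof hD as [ht hx]; apply (pd_x_unique ux w' t x); auto.
    - intros y hy; rewrite eux, ew by (now split); reflexivity.
    - now apply hd.
    - now apply hdw. }
  assert (hwx : forall t x, Dom t x -> pd_x w t x (wx t x)).
  { intros t x hD; pose proof hD as [ht hx].
    apply (has_deriv_within_ext _ (fun y => w' t y)); [exact hx| |now apply hdw].
    intros y hy; apply ew; now split. }
  assert (hint : forall (g : R -> R) x l, 0 < x -> has_deriv_within halfline g x l -> is_derive g x l).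
  { intros g x l; apply has_deriv_within_interior; intros y hy; now left. }
  assert (hintt : forall (g : R -> R) t l, 0 < t -> has_deriv_within pos_halfline g t l -> is_derive g t l).
  { intros g t l; apply has_deriv_within_interior; intros y hy; exact hy. }
  assert (hmix : forall t x, 0 < t -> 0 < x -> utx t x = wt t x).
  { apply (schwarz_quadrant u ut' w' utx wt); intros t x ht hx.
    assert (hD : Dom t x) by (split; lra).
    split; [|split; [|split; [|split; [|split]]]].
    - apply hintt; [exact ht | now apply hd'].
    - apply hint; [exact hx | now apply hd'].
    - apply hint; [exact hx | now apply hdt].
    - apply hintt; [exact ht | now apply hdw].
    - now apply cont2_on_Dom_interior.
    - now apply cont2_on_Dom_interior. }
  exists w, wt, wx, wxx; split; [exact hw|]; split; [|split].
  - intros T hT; destruct (hcb T hT) as (_ & _ & h1 & h2); now split.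
  - intros t x ht hx; assert (hD : Dom t x) by (split; lra).
    assert (hwt : is_derive (fun s => w s x) t (wt t x)).
    { apply (is_derive_ext_loc (fun s => w' s x)).
      - apply locally_pos; [exact ht|]; intros s hs; apply ew; split; lra.
      - apply hintt; [exact ht | now apply hdw]. }
    assert (hwxx : is_derive (wx t) x (wxx t x)) by (apply hint; [exact hx | now apply hdwx]).
    assert (hwx' : is_derive (w t) x (wx t x)) by (apply hint; [exact hx | now apply hwx]).
    split; [exact hwt|]; split; [exact hwx'|]; split; [exact hwxx|].
    rewrite <- hmix by assumption.
    assert (h1 : is_derive (ut' t) x (utx t x)) by (apply hint; [exact hx | now apply hdt]).
    assert (h2 : is_derive (fun y => mu * w t y + / 2 * wx t y) x (mu * wx t x + / 2 * wxx t x)).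
    { apply (is_derive_plus (fun y => mu * w t y) (fun y => / 2 * wx t y)).
      - now apply (is_derive_scal (w t) x mu).
      - now apply (is_derive_scal (wx t) x (/ 2)). }
    rewrite <- (is_derive_unique _ _ _ h1), <- (is_derive_unique _ _ _ h2).
    apply Derive_ext_loc, locally_pos; [exact hx|]; intros y hy.
    assert (hDy : Dom t y) by (split; lra).
    now rewrite eut, hpde, eux, euxx by assumption.
  - intros t ht; assert (hD : Dom t 0) by (split; lra).
    replace (2 * (nu - mu) * w t 0) with (wx t 0); [now apply hwx|].
    pose proof (hpde t 0 hD) as e; rewrite (hbc t ht), eux, euxx in e by exact hD; lra.
Qed.

Lemma cont2_on_minus (S : R -> R -> Prop) (u v : R -> R -> R) :
  cont2_on S u -> cont2_on S v -> cont2_on S (fun t x => u t x - v t x).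
Proof.
  intros hu hv t x hS eps he.
  destruct (hu t x hS (eps / 2) ltac:(lra)) as [d1 [hd1 H1]].
  destruct (hv t x hS (eps / 2) ltac:(lra)) as [d2 [hd2 H2]].
  exists (Rmin d1 d2); split; [now apply Rmin_glb_lt|]; intros s y hs h1 h2.
  pose proof (Rmin_l d1 d2); pose proof (Rmin_r d1 d2).
  specialize (H1 s y hs ltac:(lra) ltac:(lra)); specialize (H2 s y hs ltac:(lra) ltac:(lra)).
  replace (u s y - v s y - (u t x - v t x)) with ((u s y - u t x) - (v s y - v t x)) by ring.
  eapply Rle_lt_trans; [apply Rabs_triang|]; rewrite Rabs_Ropp; lra.
Qed.

Lemma bdd2_on_minus (S : R -> R -> Prop) (u v : R -> R -> R) :
  bdd2_on S u -> bdd2_on S v -> bdd2_on S (fun t x => u t x - v t x).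
Proof.
  intros [M hM] [N hN]; exists (M + N); intros t x hS.
  specialize (hM t x hS); specialize (hN t x hS).
  eapply Rle_trans; [apply Rabs_triang|]; rewrite Rabs_Ropp; lra.
Qed.

(** The maximum principle is applied to the difference of the slopes with the evaluation time [t] as
    horizon. At time [0] both slopes are the derivative of [f], and the Robin condition is linear.
    Exchanging [u] and [v] gives equality. *)
Lemma slope_le (mu nu : R) (f : R -> R) (u v wu wv : R -> R -> R) :
  is_solution mu nu f u -> is_solution mu nu f v ->
  (forall t x, 0 <= t -> 0 <= x -> pd_x u t x (wu t x)) ->
  (forall t x, 0 <= t -> 0 <= x -> pd_x v t x (wv t x)) ->
  forall t x, 0 < t -> 0 <= x -> wu t x <= wv t x.
Proof.
  intros hu hv du dv t x ht hx.
  destruct (slope_robin_problem mu nu f u hu) as (w1 & w1t & w1x & w1xx & d1 & c1 & p1 & b1).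
  destruct (slope_robin_problem mu nu f v hv) as (w2 & w2t & w2x & w2xx & d2 & c2 & p2 & b2).
  assert (ht0 : 0 <= t) by lra.
  rewrite (pd_x_unique u u t x _ _ hx (fun _ _ => eq_refl) (du t x ht0 hx) (d1 t x ht0 hx)).
  rewrite (pd_x_unique v v t x _ _ hx (fun _ _ => eq_refl) (dv t x ht0 hx) (d2 t x ht0 hx)).
  apply Rminus_le.
  destruct (c1 t ht) as [c1a c1b]; destruct (c2 t ht) as [c2a c2b].
  apply (robin_le0 mu (2 * (nu - mu)) t (fun t x => w1 t x - w2 t x)
    (fun t x => w1t t x - w2t t x) (fun t x => w1x t x - w2x t x)
    (fun t x => w1xx t x - w2xx t x) ht).
  - now apply cont2_on_minus.
  - now apply bdd2_on_minus.
  - intros y hy; apply Rminus_diag_eq.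
    apply (pd_x_unique u v 0 y); auto.
    + intros z hz; transitivity (f z); [|symmetry]; [apply hu | apply hv]; exact hz.
    + apply d1; lra.
    + apply d2; lra.
  - intros s y hs hy.
    destruct (p1 s y hs hy) as (p1a & p1b & p1c & p1d).
    destruct (p2 s y hs hy) as (p2a & p2b & p2c & p2d).
    split; [|split; [|split]].
    + now apply (is_derive_minus (fun s => w1 s y) (fun s => w2 s y)).
    + now apply (is_derive_minus (w1 s) (w2 s)).
    + now apply (is_derive_minus (w1x s) (w2x s)).
    + rewrite p1d, p2d; ring.
  - intros s hs; replace (2 * (nu - mu) * (w1 s 0 - w2 s 0))
      with (2 * (nu - mu) * w1 s 0 - 2 * (nu - mu) * w2 s 0) by ring.
    apply has_deriv_within_minus; auto.
  - unfold strip; lra.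
Qed.

Lemma solution_unique (mu nu : R) (f : R -> R) (u v : R -> R -> R) :
  is_solution mu nu f u -> is_solution mu nu f v ->
  forall t x, 0 <= t -> 0 <= x -> v t x = u t x.
Proof.
  intros hu hv t x [ht|<-] hx.
  - destruct (slope_robin_problem mu nu f u hu) as (wu & _ & _ & _ & du & _).
    destruct (slope_robin_problem mu nu f v hv) as (wv & _ & _ & _ & dv & _).
    assert (hconst : forall y, 0 <= y -> v t y - u t y = v t 0 - u t 0).
    { apply (has_deriv_within_zero_const (fun y => v t y - u t y)); intros y hy.
      replace 0 with (wv t y - wu t y).
      - apply has_deriv_within_minus; [apply dv | apply du]; lra.
      - apply Rminus_diag_eq, Rle_antisym.
        + now apply (slope_le mu nu f v u wv wu).
        + now apply (slope_le mu nu f u v wu wv). }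
    apply eq_of_Rabs_lt; intros eps he.
    destruct hu as (_ & _ & lu & _); destruct hv as (_ & _ & lv & _).
    destruct (lu t ht (eps / 2) ltac:(lra)) as [A hA].
    destruct (lv t ht (eps / 2) ltac:(lra)) as [B hB].
    set (y := Rmax 0 (Rmax A B)).
    pose proof (Rmax_l 0 (Rmax A B)); pose proof (Rmax_r 0 (Rmax A B)).
    pose proof (Rmax_l A B); pose proof (Rmax_r A B).
    specialize (hA y ltac:(unfold y; lra)); specialize (hB y ltac:(unfold y; lra)).
    rewrite (hconst x hx), <- (hconst y) by (unfold y; lra).
    eapply Rle_lt_trans; [apply Rabs_triang|]; rewrite Rabs_Ropp; lra.
  - transitivity (f x); [|symmetry]; [apply hv | apply hu]; exact hx.
Qed.

Theorem theorem1 (mu nu : R) (f : R -> R)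
  (hf : C1b_halfline f) (hlim : tends_to_0_at_infty f) :
  exists u : R -> R -> R, is_solution mu nu f u /\
    forall v : R -> R -> R, is_solution mu nu f v ->
      forall t x, 0 <= t -> 0 <= x -> v t x = u t x.
Proof.
  destruct (solution_exists mu nu f hf hlim) as [u hu].
  exists u; split; [exact hu|]; intros v hv; now apply (solution_unique mu nu f).
Qed.
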